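(* Let $G$ be a 3-connected claw-free graph and let $S\subseteq V(G)$ be a set with $k\le 6$ vertices. Then for every vertex $z\in S$, $G$ has a cycle that avoids $z$ but contains all the remaining $k-1$ vertices of $S\setminus\{z\}$.
   Context: Graphs are finite and simple. A graph is claw-free if it contains no induced subgraph isomorphic to $K_{1,3}$. *)

(* Defs.v *)
(* A finite simple graph is a symmetric irreflexive relation
   [e] on a [finType] of vertices. *)
From mathcomp Require Import all_boot.

Set Implicit Arguments.
Unset Strict Implicit.
Unset Printing Implicit Defensive.

Definition simple_graph (V : finType) (e : rel V) : Prop :=
  symmetric e /\ irreflexive e.

Definition induced_rel (V : finType) (e : rel V) (A : {set V}) : rel V :=
  [rel x y | [&& x \in A, y \in A & e x y]].

Definition connected_on (V : finType) (e : rel V) (A : {set V}) : Prop :=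
  {in A &, forall x y, connect (induced_rel e A) x y}.

(* More than [k] vertices are required, so the complete graph on [k] vertices
   is not k-connected, while the one on [k.+1] vertices is. *)
Definition k_connected (k : nat) (V : finType) (e : rel V) : Prop :=
  k < #|V| /\ forall X : {set V}, #|X| < k -> connected_on e (~: X).

Definition complete_bipartite (m n : nat) : rel ('I_m + 'I_n) :=
  fun u v => match u, v with
             | inl _, inr _ | inr _, inl _ => true
             | _, _ => false
             end.

Definition has_induced (H : finType) (h : rel H) (V : finType) (e : rel V)
  : Prop :=
  exists f : H -> V, injective f /\ forall u v, e (f u) (f v) = h u v.

Definition claw_free (V : finType) (e : rel V) : Prop :=
  ~ has_induced (@complete_bipartite 1 3) e.

(* [ucycle] alone accepts the empty sequence and a single edge traversed back
   and forth; a graph cycle has at least three vertices. *)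
Definition graph_cycle (V : finType) (e : rel V) (c : seq V) : Prop :=
  2 < size c /\ ucycle e c.

(* Main.v *)
Require Import Defs.
From mathcomp Require Import all_boot zify.

Set Implicit Arguments.
Unset Strict Implicit.
Unset Printing Implicit Defensive.

(** Let H = G - z. Local completion does not change which vertex sets are covered by a cycle,
    so H may be assumed diamond-free; then every vertex lies in at most two maximal cliques
    ("nodes") and H is a line graph. A frame is a system of disjoint paths ("legs") of H whose
    ends meet three by three in nodes, that is, the line graph of a subdivided cubic multigraph;
    a closed trail of the multigraph gives a cycle of H that also absorbs any vertex of a node
    it visits. A cycle through at most four of the given vertices ("specials") and an ear through
    one more form a frame with three legs. By Menger's theorem a leg carrying specials either
    sends a third path to the rest of the frame, which refines the frame, or is cut off by two
    vertices, in which case z has a neighbour behind that cut; as z is not the centre of a claw,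
    of three legs with specials at most two are cut off. Branching over all outcomes is a finite
    search over small multigraphs, up to isomorphism, and it always ends with a closed trail
    covering all specials. *)

(** * Nodes and linked paths *)

(** Deleting [z] leaves a graph that is only 2-connected, and its cuts by two vertices are the
    obstacle. What H keeps of the connectivity of G is collected in [apex_connected]: three
    properties that persist when edges are added, so that completions can be iterated without
    returning to G. A single leg may well be cut off; this is why the branching always works on
    three legs with specials at once. The search forgets the graph and keeps only a multigraph with
    the number of specials on each leg. Specials that end up at a branching point belong to no leg
    in particular; they are recorded as labels that the closed trail has to visit. The bound 6
    leaves five specials besides [z]: at most four on a cycle and one on the ear. *)

Definition clawless (T : finType) (h : rel T) : Prop :=
  forall y a b c, h y a -> h y b -> h y c -> uniq [:: a; b; c] ->
  [|| h a b, h a c | h b c].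

Definition diamondless (T : finType) (h : rel T) : Prop :=
  forall x y a b, h x y -> h x a -> h y a -> h x b -> h y b -> a != b -> h a b.

Section LineStructure.
Variables (T : finType) (h : rel T).
Hypotheses (hsym : symmetric h) (hirr : irreflexive h).
Hypotheses (hclaw : clawless h) (hdia : diamondless h).

Lemma h_neq x y : h x y -> x != y.
Proof. by apply: contraTneq => ->; rewrite hirr. Qed.

(** For an edge [x y] of a diamond-free graph this is the unique maximal clique containing the
    edge. *)
Definition node (x y : T) : {set T} := [set w | [|| w == x, w == y | h w x && h w y]].

Definition isnode (C : {set T}) : bool := [exists x, exists y, h x y && (C == node x y)].

Lemma isnodeP C : reflect (exists x y, h x y /\ C = node x y) (isnode C).
Proof.
apply: (iffP existsP) => [[x /existsP[y /andP[hxy /eqP ->]]]|[x [y [hxy ->]]]].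
  by exists x, y.
by exists x; apply/existsP; exists y; rewrite hxy eqxx.
Qed.

Lemma node_l x y : x \in node x y. Proof. by rewrite inE eqxx. Qed.
Lemma node_r x y : y \in node x y. Proof. by rewrite inE eqxx orbT. Qed.

Lemma node_adj x y a b : h x y -> a \in node x y -> b \in node x y -> a != b -> h a b.
Proof.
move=> hxy; rewrite !inE.
case/or3P=> [/eqP->|/eqP->|/andP[ax ay]]; case/or3P=> [/eqP->|/eqP->|/andP[bx b_y]];
  rewrite ?eqxx // => ab; do ?[by [|rewrite hsym]].
by apply: (hdia hxy) => //; rewrite hsym.
Qed.

Lemma isnode_adj C a b : isnode C -> a \in C -> b \in C -> a != b -> h a b.
Proof. by case/isnodeP=> x [y [hxy ->]]; apply: node_adj. Qed.

Lemma node_sub x y a b : h x y -> a \in node x y -> b \in node x y -> h a b ->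
  node x y \subset node a b.
Proof.
move=> hxy ha hb hab; apply/subsetP => w hw; rewrite inE.
case: eqVneq => //= wa; case: eqVneq => //= wb.
by rewrite !(node_adj hxy).
Qed.

Lemma node_eq x y a b : h x y -> a \in node x y -> b \in node x y -> a != b ->
  node x y = node a b.
Proof.
move=> hxy ha hb ab; have hab := node_adj hxy ha hb ab.
apply/eqP; rewrite eqEsubset node_sub //=; apply: node_sub => //.
  by move: (node_sub hxy ha hb hab) => /subsetP/(_ x); apply; apply: node_l.
by move: (node_sub hxy ha hb hab) => /subsetP/(_ y); apply; apply: node_r.
Qed.

Lemma isnode_through C q : isnode C -> q \in C -> exists2 y, h q y & C = node q y.
Proof.
case/isnodeP=> x [y [hxy ->]] hq.
have [qx|qx] := eqVneq q x; first by exists y; rewrite qx.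
exists x; first by apply: node_adj hxy _ _ _; rewrite ?node_l.
by apply: node_eq; rewrite ?node_l.
Qed.

Lemma isnode_node x y : h x y -> isnode (node x y).
Proof. by move=> hxy; apply/isnodeP; exists x, y. Qed.

(** Adjacent neighbours of [q] span the same node with [q], so three different nodes would give
    three pairwise nonadjacent neighbours, a claw at [q]. *)
Lemma node_pigeon C1 C2 C3 q : isnode C1 -> isnode C2 -> isnode C3 ->
  q \in C1 -> q \in C2 -> q \in C3 -> [|| C1 == C2, C1 == C3 | C2 == C3].
Proof.
move=> /isnode_through h1 /isnode_through h2 /isnode_through h3 /h1[a ha ->] /h2[b hb ->] /h3[c
  hc ->].
have key x y : h q x -> h q y -> h x y || (x == y) -> node q x == node q y.
  move=> hx hy /orP[xy|/eqP->//]; apply/eqP; apply: node_eq; rewrite ?node_l ?h_neq //.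
  by rewrite inE (hsym y x) xy (hsym y q) hy /= !orbT.
have [E|ab] := boolP (h a b || (a == b)); first by rewrite (key a b).
have [E|ac] := boolP (h a c || (a == c)); first by rewrite (key a c) ?orbT.
have [E|bc] := boolP (h b c || (b == c)); first by rewrite (key b c) ?orbT.
move: ab ac bc; rewrite !negb_or => /andP[n1 d1] /andP[n2 d2] /andP[n3 d3].
have := hclaw ha hb hc; rewrite /= !inE negb_or d1 d2 d3 (negPf n1) (negPf n2) (negPf n3).
by move=> /(_ isT).
Qed.

(** A leg without vertices is allowed when its two end nodes coincide. *)
Definition linked (C : {set T}) (p : seq T) (D : {set T}) : bool :=
  if p is x :: p' then [&& x \in C, path h x p' & last x p' \in D] else C == D.

(** The two paths meet in the clique [D] at different vertices, hence at adjacent ones. *)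
Lemma linked_cat C p D q E : isnode D -> uniq (p ++ q) ->
  linked C p D -> linked D q E -> linked C (p ++ q) E.
Proof.
move=> nD; case: p => [|x p]; first by move=> _ /eqP->.
case: q => [|y q]; first by rewrite cats0 => _ + /eqP<-.
rewrite cat_uniq => /and3P[_ /hasPn hn _] /= /and3P[-> px lD] /and3P[yD py lE].
rewrite cat_path last_cat /= px py lE !andbT /=.
apply: isnode_adj nD lD yD _.
by apply: contraNneq (hn y (mem_head _ _)) => <-; apply: mem_last.
Qed.

Lemma linked1 (C : {set T}) q (D : {set T}) : q \in C -> q \in D -> linked C [:: q] D.
Proof. by move=> /= -> ->. Qed.

Lemma linked_rev C p D : linked C p D -> linked D (rev p) C.
Proof.
case: p => [|x p]; first by rewrite /= eq_sym.
rewrite lastI rev_rcons -lastI /= => /and3P[xC px ->] /=.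
rewrite rev_path (eq_path (e' := h)) => [|u v]; last by rewrite hsym.
by rewrite px /=; case: p {px} => //= y p; rewrite rev_cons last_rcons.
Qed.
(** On either side of [q] the node is that of the path edge at [q], or the end node if [q] is the
    end of the path. *)
Lemma linked_arms C p q r D : isnode C -> isnode D -> linked C (p ++ q :: r) D ->
  (exists X, [/\ isnode X, q \in X & linked C p X]) /\
  (exists Y, [/\ isnode Y, q \in Y & linked Y r D]).
Proof.
move=> nC nD H; split.
  case: p H => [|x p] /=; first by case/and3P=> qC _ _; exists C; rewrite /= eqxx.
  rewrite cat_path last_cat /= => /and3P[xC /and3P[px e1 _] _].
  by exists (node (last x p) q); rewrite isnode_node ?node_r //= xC px node_l.
case: r H => [|y r] H.
  have qD : q \in D.
    case: p H => [|x p] /=; first by case/andP.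
    by rewrite last_cat => /and3P[].
  by exists D; rewrite /= eqxx.
have aux z s : path h z (s ++ [:: q, y & r]) -> last z (s ++ [:: q, y & r]) \in D ->
    exists Y, [/\ isnode Y, q \in Y & linked Y (y :: r) D].
  rewrite cat_path last_cat /= => /and4P[_ _ qy yr] lD.
  by exists (node q y); rewrite isnode_node ?node_l //= node_r yr.
case: p H => [|x p] /= /and3P[_ H1 H2]; last exact: aux H1 H2.
case/andP: H1 => qy yr.
by exists (node q y); rewrite isnode_node ?node_l //= node_r yr.
Qed.

(* Only two nodes contain q, so two of the three arms end in the same node. *)
Lemma star C1 p1 D1 C2 p2 D2 C3 p3 D3 q :
  isnode D1 -> isnode D2 -> isnode D3 -> q \in D1 -> q \in D2 -> q \in D3 ->
  linked C1 p1 D1 -> linked C2 p2 D2 -> linked C3 p3 D3 ->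
  uniq (q :: p1 ++ p2 ++ p3) ->
  exists D b1 b2 b3, [/\ isnode D, q \in D, b1 + b2 + b3 = 1 &
    [/\ linked C1 (p1 ++ nseq b1 q) D, linked C2 (p2 ++ nseq b2 q) D &
        linked C3 (p3 ++ nseq b3 q) D]].
Proof.
move=> n1 n2 n3 q1 q2 q3 l1 l2 l3 u.
have ext (C : {set T}) p (D D' : {set T}) : isnode D -> q \in D -> q \in D' -> linked C p D ->
  q \notin p ->
    uniq p -> linked C (p ++ nseq 1 q) D'.
  move=> nD qD qD' l qp up; apply: linked_cat nD _ l (linked1 qD qD').
  by rewrite cat_uniq up /= orbF qp.
move: u; rewrite cons_uniq !mem_cat !negb_or !cat_uniq =>
  /andP[/and3P[u1 u2 u3] /and3P[v1 _ /and3P[v2 _ v3]]].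
(* Two arms end in the same node; the remaining one is prolonged by [q] to reach it. *)
case/or3P: (node_pigeon n1 n2 n3 q1 q2 q3) => /eqP E; subst.
- exists D2, 0, 0, 1; rewrite /= !cats0; split=> //; split=> //; exact: ext q3 _ _ _ _.
- exists D3, 0, 1, 0; rewrite /= !cats0; split=> //; split=> //; exact: ext q2 _ _ _ _.
- exists D3, 1, 0, 0; rewrite /= !cats0; split=> //; split=> //; exact: ext q1 _ _ _ _.
Qed.
End LineStructure.

(** * Local completion *)

Section Weight.
Variables (T : eqType) (x0 : T) (d : T -> T -> nat).
Hypothesis dC : forall a b, d a b = d b a.

Fixpoint weight (p : seq T) : nat :=
  if p is y :: s then (if s is z :: _ then d y z else 0) + weight s else 0.

Definition cost (p : seq T) : nat := weight p + d (last x0 p) (head x0 p).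

Lemma weight_cat p q : p != [::] -> q != [::] ->
  weight (p ++ q) = weight p + d (last x0 p) (head x0 q) + weight q.
Proof.
move=> pn; case: q => [|z q] // _; elim: p pn => [|y [|y' p] IH] //= _.
by move: IH => /= ->; rewrite ?addnA.
Qed.

Lemma last_rev p : last x0 (rev p) = head x0 p.
Proof. by case: p => //= y p; rewrite rev_cons last_rcons. Qed.

Lemma head_rev p : head x0 (rev p) = last x0 p.
Proof. by rewrite -{2}(revK p) last_rev. Qed.

Lemma nil_rev (p : seq T) : (rev p == [::]) = (p == [::]).
Proof. by rewrite -!size_eq0 size_rev. Qed.

Lemma nil_cat (p q : seq T) : (p ++ q == [::]) = (p == [::]) && (q == [::]).
Proof. by case: p. Qed.

Lemma last_catn p q : q != [::] -> last x0 (p ++ q) = last x0 q.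
Proof. by case: q => // y q _; rewrite last_cat. Qed.

Lemma head_catn p q : p != [::] -> head x0 (p ++ q) = head x0 p.
Proof. by case: p. Qed.

Lemma weight_rev p : weight (rev p) = weight p.
Proof.
elim: p => // y p IH; rewrite rev_cons -cats1; case: (eqVneq p [::]) => [->|pn] //=.
rewrite weight_cat ?nil_rev // IH last_rev; case: p pn {IH} => //= z q _.
by rewrite (dC z y); lia.
Qed.

Lemma cost_rev p : cost (rev p) = cost p.
Proof. by rewrite /cost weight_rev last_rev head_rev dC. Qed.

Lemma weight1 z : weight [:: z] = 0. Proof. by []. Qed.

Definition weightE := (weight_cat, last_catn, head_catn, weight_rev, last_rev, head_rev, weight1).

Lemma cost_catC p q : p != [::] -> q != [::] -> cost (p ++ q) = cost (q ++ p).
Proof. by move=> pn qn; rewrite /cost !weightE //; lia. Qed.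

Lemma weight_gt0 p : 0 < weight p ->
  exists A B, [/\ p = A ++ B, A != [::], B != [::] & 0 < d (last x0 A) (head x0 B)].
Proof.
elim: p => [|y [|z p] IH] //=.
case: (posnP (d y z)) => [-> /IH[A [B [e nA nB dAB]]]|dyz _].
  exists (y :: A), B; rewrite e; split=> //.
  by case: A nA dAB {e}.
by exists [:: y], (z :: p).
Qed.

(** A rotation moves a pair of positive cost to the closing position. *)
Lemma cost_gt0 p : 0 < cost p ->
  exists q, [/\ perm_eq q p, cost q = cost p & 0 < d (last x0 q) (head x0 q)].
Proof.
move=> cp; case: (posnP (d (last x0 p) (head x0 p))) => [e|dp]; last by exists p.
have /weight_gt0[A [B [ep nA nB dAB]]] : 0 < weight p by move: cp; rewrite /cost e addn0.
exists (B ++ A); rewrite ep; split; [by rewrite perm_catC|exact: cost_catC|].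
by rewrite !weightE.
Qed.
End Weight.

(* The local completion of Ryjacek's closure. *)
Definition completion (T : finType) (h : rel T) (x : T) : rel T :=
  fun u v => h u v || [&& u != v, h x u & h x v].

Section Completion.
Variables (T : finType) (h : rel T) (x : T).
Hypotheses (hsym : symmetric h) (hirr : irreflexive h) (hclaw : clawless h).

Notation h1 := (completion h x).

Lemma completion_sym : symmetric h1.
Proof. by move=> u v; rewrite /completion hsym eq_sym (andbC (h x u)). Qed.

Lemma completion_irr : irreflexive h1.
Proof. by move=> u; rewrite /completion hirr eqxx. Qed.

(** In a claw of the completion with an added edge [y a], the leaves [b] and [c] are not neighbours
    of [x], since otherwise they would be joined to [a]. So [y b] and [y c] are old edges, and [x],
    [b], [c] form a claw at [y] already in [h]. *)
Lemma completion_clawless : clawless h1.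
Proof.
have key y a b c : h1 y a -> h1 y b -> h1 y c -> uniq [:: a; b; c] ->
    ~~ h1 a b -> ~~ h1 a c -> ~~ h1 b c -> ~~ h y a -> False.
  move=> ya yb yc u nab nac nbc nya; move: (ya);
    rewrite /completion (negPf nya) /= => /and3P[_ xy xa].
  move: u; rewrite /= !inE negb_or => /andP[/andP[ab ac] /andP[bc _]].
  have out w : h1 y w -> a != w -> ~~ h1 a w -> h y w /\ ~~ h x w.
    move=> yw aw; rewrite /completion aw xa /= negb_or => /andP[_ nxw]; split=> //.
    by move: yw; rewrite /completion (negPf nxw) !andbF orbF.
  have [hyb nxb] := out _ yb ab nab; have [hyc nxc] := out _ yc ac nac.
  have nx w : h1 y w -> a != w -> ~~ h1 a w -> x != w.
    move=> yw aw; apply: contraNneq => <-; by rewrite /completion hsym xa.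
  have := hclaw (_ : h y x) hyb hyc; rewrite hsym xy => /(_ isT).
  rewrite /= !inE negb_or (nx _ yb ab nab) (nx _ yc ac nac) bc (negPf nxb) (negPf nxc) =>
    /(_ isT) /=.
  by move=> hbc; move: nbc; rewrite /completion hbc.
move=> y a b c ya yb yc u; apply: contraT => /norP[nab /norP[nac nbc]]; exfalso.
have cs p q : ~~ h1 p q -> ~~ h1 q p by rewrite completion_sym.
have [ha|na] := boolP (h y a); last exact: (key _ _ _ _ ya yb yc u nab nac nbc na).
have [hb|nb] := boolP (h y b); last first.
  apply: (key y b a c) => //; last exact: cs.
  by move: u; rewrite /= !inE !negb_or eq_sym => /andP[/andP[-> ->] /andP[-> _]].
have [hc|nc] := boolP (h y c); last first.
  apply: (key y c a b) => //; try exact: cs.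
  by move: u; rewrite /= !inE !negb_or [c == a]eq_sym [c == b]eq_sym =>
    /andP[/andP[-> ->] /andP[-> _]].
have := hclaw ha hb hc u; move: nab nac nbc; rewrite /completion !negb_or.
by move=> /andP[/negPf-> _] /andP[/negPf-> _] /andP[/negPf-> _].
Qed.

(** * Replacing cycles of the completion by cycles of the graph *)

Section Cycles.
Variables (b a c : T).
Hypotheses (xb : h x b) (xa : h x a) (xc : h x c) (hba : h b a) (hbc : h b c)
  (ac : a != c) (nac : ~~ h a c).

(* The last value is larger than the cost of any cycle of the completion. *)
Definition edge_cost (p q : T) : nat := if h p q then 0 else if h1 p q then 1 else #|T|.+1.

Lemma edge_costC p q : edge_cost p q = edge_cost q p.
Proof. by rewrite /edge_cost hsym completion_sym. Qed.

Lemma edge_cost0 p q : h p q -> edge_cost p q = 0.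
Proof. by rewrite /edge_cost => ->. Qed.

Lemma edge_cost_gt0 p q : (0 < edge_cost p q) = ~~ h p q.
Proof. by rewrite /edge_cost; case: (h p q) => //; case: ifP. Qed.

Lemma edge_cost1 p q : h x p -> h x q -> p != q -> edge_cost p q <= 1.
Proof. by rewrite /edge_cost /completion => -> -> ->; rewrite orbT; case: (h p q). Qed.

Notation cst := (cost x edge_cost).
Notation wt := (weight edge_cost).
Let wE := (weightE x edge_costC).

(** Minimality ranges over supersets and not only over reorderings, so that a missing vertex may be
    inserted. *)
Definition tight (p : seq T) : Prop :=
  uniq p /\ forall q, uniq q -> {subset p <= q} -> cst p <= cst q.

Lemma tight_le p q : tight p -> uniq q -> {subset p <= q} -> cst q <= cst p -> tight q.
Proof.
move=> [up tp] uq sq le; split=> // r ur sr; apply: leq_trans le (tp _ ur _).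
by move=> y /sq/sr.
Qed.

Lemma tight_perm p q : tight p -> perm_eq q p -> cst p <= cst q.
Proof.
by move=> [up tp] pq; apply: tp; [rewrite (perm_uniq pq)|move=> y; rewrite (perm_mem pq)].
Qed.

Lemma tight_rev p : tight p -> tight (rev p).
Proof.
move=> [up tp]; split; first by rewrite rev_uniq.
move=> q uq sq; rewrite (cost_rev _ edge_costC); apply: tp => // y yp.
by apply: sq; rewrite mem_rev.
Qed.

(** A closed sequence of least cost, rotated so that its closing pair is an added edge [u v]; this
    is the situation to be excluded. *)
Definition open_at (p : seq T) (u v : T) : Prop :=
  [/\ tight p, head x p = v, last x p = u, h x u & h x v] /\ (u != v /\ ~~ h u v).

Lemma open_rev p u v : open_at p u v -> open_at (rev p) v u.
Proof.
move=> [[tp hp lp xu xv] [uv huv]]; split; last by rewrite eq_sym hsym.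
by split=> //; [apply: tight_rev|rewrite head_rev|rewrite last_rev].
Qed.

Lemma improve p q : tight p -> perm_eq q p -> cst q < cst p -> False.
Proof. by move=> tp /(tight_perm tp); rewrite leqNgt => /negP. Qed.

Lemma open_move p q u v w : open_at p u v -> perm_eq q p -> cst q <= cst p ->
  head x q = v -> last x q = w -> h x w -> w != v -> ~~ h w v -> open_at q w v.
Proof.
move=> [[tp hp lp xu xv] _] pq le hq lq xw wv hwv; split=> //; split=> //.
by apply: (tight_le tp _ _ le); rewrite ?(perm_uniq pq) ?(proj1 tp) // => y; rewrite (perm_mem pq).
Qed.

(** If [y z] is an added edge, then [y] is a neighbour of [x] and [y w] costs at most 1; if [y z] is
    outside the completion, it already has the largest cost. *)
Lemma cost_le_step z w y : (z == x) || h x z -> h x w -> w != y -> ~~ h y z ->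
  edge_cost y w <= edge_cost y z.
Proof.
rewrite {2}/edge_cost => zx xw wy hyz; rewrite (negPf hyz); case: ifP => [yz|_].
  apply: edge_cost1; rewrite // 1?eq_sym //; move: yz;
    rewrite /completion (negPf hyz) /= => /and3P[_ //].
by rewrite /edge_cost; do 2!case: ifP => // _.
Qed.

Ltac nz := rewrite ?(nil_cat, nil_rev) ?negb_and;
  repeat match goal with H : is_true (_ != [::]) |- _ => rewrite H end; rewrite ?orbT //.
Ltac calc := rewrite /cost !wE; try by nz.
Ltac plia := apply/permP => ?; rewrite !(count_cat, count_rev) /=; clear; lia.

Section Hub.
Variables (p : seq T) (u v : T).
Hypothesis op : open_at p u v.

Lemma open_gt0 : 0 < edge_cost u v. Proof. by rewrite edge_cost_gt0; case: op => _ []. Qed.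

(** Inserting [m] between [u] and [v] would save the cost of the closing pair. *)
Lemma open_superset m : m \notin p -> h m u -> h m v -> False.
Proof.
move=> mp mu mv; have [[tp hp lp xu xv] _] := op; have gt := open_gt0.
have pn : p != [::] by apply: contraTneq xu => e; rewrite -lp e hirr.
have := (proj2 tp) (p ++ [:: m]); rewrite cat_uniq (proj1 tp) /= orbF mp => /(_ isT) H.
have /H : {subset p <= p ++ [:: m]} by move=> y; rewrite mem_cat => ->.
calc; rewrite hp lp /= (edge_costC u m) (edge_cost0 mu) (edge_cost0 mv); move: gt; clear; lia.
Qed.

Section Split.
Variables (A B : seq T) (z : T).
Hypotheses (ep : p = A ++ [:: z] ++ B) (nA : A != [::]) (nB : B != [::]).
Let zm := last x A.
Let zp := head x B.

Lemma split_uniq : [/\ uniq A, uniq B, z \notin A, z \notin B & forall y, y \in A -> y \notin B].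
Proof.
have [[[up _] _ _ _ _] _] := op; move: up; rewrite ep cat_uniq /= negb_or.
case/and3P=> -> /andP[zA /hasPn hB] /andP[zB ->]; split=> //.
by move=> y yA; apply/negP => /hB; rewrite /= yA.
Qed.

Lemma split_ends : [/\ zm \in A, zp \in B, head x A = v & last x B = u].
Proof.
have [[_ hp lp _ _] _] := op; move: hp lp; rewrite ep !wE; try by nz.
move=> -> ->; rewrite /zm /zp; split=> //.
  by case: (A) nA => // y s _; exact: (mem_last y s).
by case: (B) nB => // y s _; exact: (mem_head y s).
Qed.

Lemma cost_split : cst p = wt A + edge_cost zm z + edge_cost z zp + wt B + edge_cost u v.
Proof.
have [_ _ hA lB] := split_ends; rewrite ep; calc.
by rewrite hA lB /= -/zm -/zp; clear; lia.
Qed.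

(* Otherwise the cycle could be rerouted through z at a lower cost. *)
Lemma hub : (z == x) || h x z -> h z u -> h z v ->
  (h zm z /\ h zp z) /\
  [/\ ~~ h zm zp, ~~ h zm u, ~~ h zp v, (zm == v) || h zm v & (zp == u) || h zp u].
Proof.
move=> zx zu zv; have [uA uB zA zB AB] := split_uniq.
have [zmA zpB hA lB] := split_ends; have gt := open_gt0.
have [[tp hp lp xu xv] _] := op; have cp := cost_split.
have vA : v \in A by rewrite -hA; case: (A) nA => // y s _; exact: (mem_head y s).
have uB' : u \in B by rewrite -lB; case: (B) nB => // y s _; exact: (mem_last y s).
have uz := edge_cost0 zu; have vz := edge_cost0 zv.
have zmu : u != zm by apply: contraTneq uB' => ->; apply: AB.
have zpv : v != zp by apply: contraTneq vA => ->; apply: contraL zpB; apply: AB.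
(* Three ways to reconnect [A], [z] and [B] cyclically without the pair [u v], at no cost for the
   edges from [z] to [u] or [v]. *)
have q1 : perm_eq (A ++ B ++ [:: z]) p by rewrite ep; plia.
have q2 : perm_eq (A ++ rev B ++ [:: z]) p by rewrite ep; plia.
have q3 : perm_eq (A ++ [:: z] ++ rev B) p by rewrite ep; plia.
have c1 : cst (A ++ B ++ [:: z]) = wt A + edge_cost zm zp + wt B.
  by calc; rewrite hA lB /= -/zm -/zp (edge_costC u z) uz vz; clear; lia.
have c2 : cst (A ++ rev B ++ [:: z]) = wt A + edge_cost zm u + wt B + edge_cost zp z.
  by calc; rewrite hA lB /= -/zm -/zp vz; clear; lia.
have c3 : cst (A ++ [:: z] ++ rev B) = wt A + edge_cost zm z + wt B + edge_cost zp v.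
  by calc; rewrite hA lB /= -/zm -/zp uz; clear; lia.
have hm : h zm z.
  apply: contraT => nh; exfalso; apply: (improve tp q2).
  have := cost_le_step zx xu zmu nh; rewrite cp c2 (edge_costC zp z); move: gt; clear; lia.
have hp' : h zp z.
  apply: contraT => nh; exfalso; apply: (improve tp q3).
  have := cost_le_step zx xv zpv nh; rewrite cp c3 (edge_costC zp z); move: gt; clear; lia.
have n1 : ~~ h zm zp.
  apply/negP => /edge_cost0 e; apply: (improve tp q1); rewrite cp c1 e; move: gt; clear; lia.
have n2 : ~~ h zm u.
  apply/negP => /edge_cost0 e; apply: (improve tp q2); rewrite cp c2 e (edge_costC zp z);
    move: gt; clear; lia.
have n3 : ~~ h zp v.
  apply/negP => /edge_cost0 e; apply: (improve tp q3); rewrite cp c3 e; move: gt; clear; lia.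
have mp : zm != zp by apply: contraTneq zpB => <-; apply: AB.
do 2!split=> //.
  case: eqVneq => //= zmv; have := hclaw (_ : h z zm) (_ : h z zp) zv.
  rewrite hsym hm hsym hp' /= !inE negb_or mp zmv (eq_sym zp) zpv (negPf n1) (negPf n3) orbF.
  by move=> /(_ isT isT isT).
case: eqVneq => //= zpu; have := hclaw (_ : h z zm) (_ : h z zp) zu.
rewrite hsym hm hsym hp' /= !inE negb_or mp zpu (eq_sym zm) zmu (negPf n1) (negPf n2).
by move=> /(_ isT isT isT).
Qed.

(* As z may replace u in the closing pair at no extra cost, the hypothesis on open_at excludes
   even the reroutings that do not lower the cost. *)
Lemma half_hub : h x z -> h z u -> z != v -> ~~ h z v -> (forall q, open_at q z v -> False) ->
  (forall w, h x w -> ~~ h w z -> w != z -> w != v -> h w v) ->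
  [/\ h zm z, h z zp, ~~ h zm zp, ~~ h zm u & (zp == u) || h zp u].
Proof.
move=> xz zu zv nzv noz side; have [uA uB zA zB AB] := split_uniq.
have [zmA zpB hA lB] := split_ends; have gt := open_gt0.
have [[tp hp lp xu xv] _] := op; have cp := cost_split.
have vA : v \in A by rewrite -hA; case: (A) nA => // y s _; exact: (mem_head y s).
have uB' : u \in B by rewrite -lB; case: (B) nB => // y s _; exact: (mem_last y s).
have uz := edge_cost0 zu.
have vz : edge_cost z v = 1.
  by apply/eqP; rewrite eqn_leq edge_cost1 // edge_cost_gt0.
have zx : (z == x) || h x z by rewrite xz orbT.
have zmu : u != zm by apply: contraTneq uB' => ->; apply: AB.
have zpv : v != zp by apply: contraTneq vA => ->; apply: contraL zpB; apply: AB.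
have zzm : zm != z by apply: contraNneq zA => <-.
have zzp : zp != z by apply: contraNneq zB => <-.
have q1 : perm_eq (A ++ B ++ [:: z]) p by rewrite ep; plia.
have q2 : perm_eq (A ++ rev B ++ [:: z]) p by rewrite ep; plia.
have q3 : perm_eq (A ++ [:: z] ++ rev B) p by rewrite ep; plia.
have c1 : cst (A ++ B ++ [:: z]) = wt A + edge_cost zm zp + wt B + 1.
  by calc; rewrite hA lB /= -/zm -/zp (edge_costC u z) uz vz; clear; lia.
have c2 : cst (A ++ rev B ++ [:: z]) = wt A + edge_cost zm u + wt B + edge_cost zp z + 1.
  by calc; rewrite hA lB /= -/zm -/zp vz; clear; lia.
have c3 : cst (A ++ [:: z] ++ rev B) = wt A + edge_cost zm z + wt B + edge_cost zp v.
  by calc; rewrite hA lB /= -/zm -/zp uz; clear; lia.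
have mv1 : cst (A ++ B ++ [:: z]) <= cst p -> False.
  by move=> le; apply: (noz _ (open_move op q1 le _ _ xz zv nzv)); rewrite !wE //; nz.
have mv2 : cst (A ++ rev B ++ [:: z]) <= cst p -> False.
  by move=> le; apply: (noz _ (open_move op q2 le _ _ xz zv nzv)); rewrite !wE //; nz.
have hm : h zm z.
  apply: contraT => nh; exfalso; apply: mv2.
  have := cost_le_step zx xu zmu nh; rewrite cp c2 (edge_costC zp z); move: gt; clear; lia.
have hp' : h zp z.
  apply: contraT => nh; exfalso; apply: (improve tp q3).
  have := cost_le_step zx xv zpv nh; rewrite cp c3 (edge_costC zp z); move: gt; clear; lia.
have n1 : ~~ h zm zp.
  apply/negP => /edge_cost0 e; apply: mv1; rewrite cp c1 e; move: gt; clear; lia.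
have n2 : ~~ h zm u.
  apply/negP => /edge_cost0 e; apply: mv2; rewrite cp c2 e (edge_costC zp z); move: gt; clear; lia.
have mp : zm != zp by apply: contraTneq zpB => <-; apply: AB.
split=> //; first by rewrite hsym.
case: eqVneq => //= zpu; have := hclaw (_ : h z zm) (_ : h z zp) zu.
rewrite hsym hm hsym hp' /= !inE negb_or mp zpu (eq_sym zm) zmu (negPf n1) (negPf n2).
by move=> /(_ isT isT isT).
Qed.
End Split.

(** The segment [B] fits between [u] and [v], and the edge [z1 z2] closes the gap that it leaves. *)
Lemma swap A B D z1 z2 : p = A ++ [:: z1] ++ B ++ [:: z2] ++ D ->
  A != [::] -> B != [::] -> D != [::] -> h z1 z2 ->
  (head x B == u) || h (head x B) u -> (last x B == v) || h (last x B) v -> False.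
Proof.
move=> ep nA nB nD z12 hu hv; have gt := open_gt0; have [[tp hp lp xu xv] _] := op.
have hA : head x A = v by rewrite -hp ep !wE //; nz.
have lD : last x D = u by rewrite -lp ep !wE //; nz.
have uD : u \in D by rewrite -lD; case: (D) nD => // y s _; exact: (mem_last y s).
have vA : v \in A by rewrite -hA; case: (A) nA => // y s _; exact: (mem_head y s).
have hB : head x B \in B by case: (B) nB => // y s _; exact: (mem_head y s).
have lB : last x B \in B by case: (B) nB => // y s _; exact: (mem_last y s).
have : uniq ((A ++ B ++ D) ++ [:: z1; z2]).
  by rewrite (perm_uniq (_ : perm_eq _ p)) ?(proj1 tp) // ep; plia.
rewrite cat_uniq => /and3P[+ _ _]; rewrite !cat_uniq => /and3P[_ /hasPn d1 /and3P[_ /hasPn d2 _]].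
have {}hu : h (head x B) u.
  by case/orP: hu => // /eqP e; have := d2 u uD; rewrite -e /= hB.
have {}hv : h (last x B) v.
  case/orP: hv => // /eqP e; have := d1 (last x B); rewrite mem_cat lB e /= vA.
  by move=> /(_ isT).
have pq : perm_eq (A ++ [:: z1] ++ [:: z2] ++ D ++ B) p by rewrite ep; plia.
apply: (improve tp pq); rewrite ep; calc.
rewrite hA lD /= (edge_cost0 z12) (edge_cost0 hv) (edge_costC u) (edge_cost0 hu).
by move: gt; clear; lia.
Qed.
End Hub.

Lemma split_at (s : seq T) z : z \in s -> exists A B, s = A ++ [:: z] ++ B.
Proof. by case/splitPr=> A B; exists A, B. Qed.

Lemma head_in (s : seq T) : s != [::] -> head x s \in s.
Proof. by case: s => // y s _; exact: (mem_head y s). Qed.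

Lemma last_in (s : seq T) : s != [::] -> last x s \in s.
Proof. by case: s => // y s _; exact: (mem_last y s). Qed.

Lemma open_inner p u v z A B : open_at p u v -> p = A ++ [:: z] ++ B -> z != u -> z != v ->
  A != [::] /\ B != [::].
Proof.
move=> [[_ <- <- _ _] _] -> zu zv; split; apply/negP => /eqP e; subst.
  by move: zv; rewrite /= eqxx.
by move: zu; rewrite last_cat /= eqxx.
Qed.

(** [hub] at [z1] puts the head of [B] near [u], [hub] at [z2] puts the last vertex of [B] near [v],
    and [swap] applies. *)
Lemma two_hubs p u v z1 z2 A B D : open_at p u v -> p = A ++ [:: z1] ++ B ++ [:: z2] ++ D ->
  (z1 == x) || h x z1 -> (z2 == x) || h x z2 ->
  h z1 u -> h z1 v -> h z2 u -> h z2 v -> h z1 z2 -> False.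
Proof.
move=> op ep x1 x2 z1u z1v z2u z2v z12.
have ne a1 a2 : h a1 a2 -> a1 != a2 by apply: contraTneq => ->; rewrite hirr.
have [nA nR] := open_inner op ep (ne _ _ z1u) (ne _ _ z1v).
have ep2 : p = (A ++ [:: z1] ++ B) ++ [:: z2] ++ D by rewrite ep -!catA.
have [nL nD] := open_inner op ep2 (ne _ _ z2u) (ne _ _ z2v).
have [_ [_ _ f3 _ f5]] := hub op ep nA nR x1 z1u z1v.
have [_ [_ _ _ g4 _]] := hub op ep2 nL nD x2 z2u z2v.
have nB : B != [::] by apply/negP => /eqP e; move: f3; rewrite e /= z2v.
apply: (swap op ep nA nB nD z12); first by move: f5; rewrite !wE.
by move: g4; rewrite !wE //; nz.
Qed.

(** Otherwise [x] and [m] are two adjacent hubs. *)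
Lemma open_common p u v m : open_at p u v -> h x m -> h m u -> h m v -> False.
Proof.
move=> op xm mu mv; have [[_ _ _ xu xv] _] := op.
have [xp|xp] := boolP (x \in p); last exact: (open_superset op xp xu xv).
have [mp|mp] := boolP (m \in p); last exact: (open_superset op mp mu mv).
have [A [B ep]] := split_at xp.
have xm' : m != x by apply: contraTneq xm => ->; rewrite hirr.
have mx : h m x by rewrite hsym.
move: mp; rewrite ep !mem_cat !inE (negPf xm') /= => /orP[] /split_at[A' [B' e]]; subst.
  by apply: (two_hubs (z1 := m) (z2 := x) op); rewrite ?eqxx ?xm ?orbT // -?catA.
by apply: (two_hubs (z1 := x) (z2 := m) op); rewrite ?eqxx ?xm ?orbT // -?catA.
Qed.

Definition near (u w : T) : bool := (w == u) || h w u.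

(** * The neighbourhood of [x] as two disjoint cliques, around [u] and around [v] *)

Section Sides.
Variables (p : seq T) (u v : T).
Hypothesis op : open_at p u v.

Lemma near_excl w : h x w -> near u w -> near v w -> False.
Proof.
have [[_ _ _ xu xv] [uv huv]] := op.
move=> xw /orP[/eqP->|wu] /orP[/eqP e|wv].
- by rewrite e eqxx in uv.
- by rewrite wv in huv.
- by move: wu; rewrite e hsym (negPf huv).
- exact: (open_common op xw wu wv).
Qed.

Lemma near_or w : h x w -> near u w || near v w.
Proof.
have [[_ _ _ xu xv] [uv huv]] := op => xw; rewrite /near.
case: eqVneq => //= wu; case: eqVneq => //= wv; rewrite ?orbT //.
have := hclaw xu xv xw; rewrite /= !inE negb_or uv (eq_sym u) wu (eq_sym v) wv (negPf huv).
by rewrite !(hsym w); apply.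
Qed.

Lemma near_adj w w' : h x w -> h x w' -> near u w -> near u w' -> w != w' -> h w w'.
Proof.
have [[_ _ _ xu xv] [uv huv]] := op => xw xw' nw nw' ww'.
have nv z : h x z -> near u z -> (z != v) && ~~ h z v.
  by move=> xz nz; rewrite -negb_or; apply/negP => /(near_excl xz nz).
have /andP[wv hwv] := nv w xw nw; have /andP[wv' hwv'] := nv w' xw' nw'.
have := hclaw xw xw' xv; rewrite /= !inE negb_or ww' wv wv' (negPf hwv) (negPf hwv') !orbF.
by apply.
Qed.
End Sides.

(** * An edge between the two cliques and the rerouting along it *)

Section Crossing.
Variables (p : seq T) (u v : T).
Hypothesis op : open_at p u v.
Let nexcl := near_excl op.
Let nor' := near_or op.
Let nadj := near_adj op.

Lemma near_adj_rev w w' : h x w -> h x w' -> near v w -> near v w' -> w != w' -> h w w'.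
Proof. exact: (near_adj (open_rev op)). Qed.

(** The path [a b c] in the neighbourhood of [x] cannot stay in one clique, as [a] and [c] are
    nonadjacent. *)
Lemma crossing : exists u' v', [/\ h x u', h x v', near u u', near v v' & h u' v'].
Proof.
have far w : h x w -> ~~ near u w -> near v w by move=> /nor' + /negPf nw; rewrite nw.
have [ua|/(far _ xa) va] := boolP (near u a); have [uc|/(far _ xc) vc] := boolP (near u c).
- by case/negP: nac; apply: nadj.
- have [ub|/(far _ xb) vb] := boolP (near u b); first by exists b, c.
  by exists a, b; split=> //; rewrite hsym.
- have [ub|/(far _ xb) vb] := boolP (near u b); first by exists b, a.
  by exists c, b; split=> //; rewrite hsym.
- by case/negP: nac; apply: near_adj_rev.
Qed.

(** Prepares one half of the final rerouting: the part before [x] is reordered to run from [v'] to a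
    neighbour of [x]. *)
Lemma half_path v' A B R : p = A ++ [:: v'] ++ B ++ [:: x] ++ R -> A != [::] -> R != [::] ->
  h x v' -> near v v' -> v' != v -> (forall q, open_at q v' u -> False) ->
  exists Q, [/\ perm_eq Q (A ++ [:: v'] ++ B), Q != [::], head x Q = v', h x (last x Q) &
    wt Q <= wt (A ++ [:: v'] ++ B)].
Proof.
move=> ep nA nR xv' nv' v'v noz; have [[_ hp lp xu xv] [uv huv]] := op.
have hA : head x A = v by rewrite -hp ep !wE //; nz.
have [eB|nB] := eqVneq B [::].
  exists (rev (A ++ [:: v'])); rewrite eB; split; [by rewrite perm_rev|by nz| | |by rewrite wE].
    by rewrite !wE.
  by rewrite !wE // hA.
have epx : p = (A ++ [:: v'] ++ B) ++ [:: x] ++ R by rewrite ep -!catA.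
have nL : A ++ [:: v'] ++ B != [::] by nz.
have [[xm xp] [_ _ _ f4 f5]] := hub op epx nL nR (introT orP (or_introl (eqxx x))) xu xv.
rewrite !wE in xm f4; try by nz.
have opr := open_rev op.
have nu' : ~~ near u v' by apply/negP => /(nexcl xv')/(_ nv').
have epr : rev p = rev (B ++ [:: x] ++ R) ++ [:: v'] ++ rev A.
  by rewrite ep rev_cat (rev_cat [:: v']) -!catA.
have nBR : rev (B ++ [:: x] ++ R) != [::] by nz.
have nrA : rev A != [::] by nz.
have hv'v : h v' v by case/orP: nv' => // /eqP e; rewrite e eqxx in v'v.
have [v'u hv'u] : v' != u /\ ~~ h v' u by move: nu'; rewrite /near negb_or => /andP.
have side w : h x w -> ~~ h w v' -> w != v' -> w != u -> h w u.
  move=> xw hw wv' wu; case/orP: (nor' xw) => [/orP[/eqP e|//]|nw]; first by rewrite e eqxx in wu.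
  by case/negP: hw; apply: near_adj_rev.
have := half_hub opr epr nBR nrA xv' hv'v v'u hv'u noz side.
rewrite !wE; try by nz.
move=> [g1 g2 g3 g4 g5].
have lBB := last_in nB; have hBB := head_in nB; have lAA := last_in nA.
have uall : uniq (A ++ [:: v'] ++ B ++ [:: x] ++ R) by rewrite -ep; case: op => [[[]]].
have dAB y : y \in A -> y \notin B.
  move=> yA; apply/negP => yB; move: uall; rewrite cat_uniq => /and3P[_ /hasPn H _].
  by have := H y; rewrite !mem_cat yB !orbT /= yA => /(_ isT).
have xB : x \notin B.
  move: uall; rewrite !catA -catA -catA catA; rewrite cat_uniq -!catA => /and3P[_ /hasPn H _].
  by have := H x (mem_head _ _); rewrite /= !mem_cat => /norP[_ /norP[_]].
have vA : v \in A by rewrite -hA; apply: head_in.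
have lBv : last x B != v by apply: contraTneq lBB => ->; apply: dAB.
have hBv : head x B != v by apply: contraTneq hBB => ->; apply: dAB.
have {}f4 : h (last x B) v by case/orP: f4 => // /eqP e; rewrite e eqxx in lBv.
have [xlA|nxlA] := boolP (h x (last x A)).
  exists ([:: v'] ++ B ++ A); split; [by plia|by nz|by []|by rewrite !wE //; nz|].
  rewrite !wE; try by nz.
  by rewrite hA (edge_cost0 f4); clear; lia.
(* In the remaining case the edges forced by [hub], [half_hub] and the two cliques allow a cheaper
   closed sequence with [x] between [u] and [v]. *)
exfalso.
have v'x : h v' x by rewrite hsym.
have hv'hB : h v' (head x B) by rewrite hsym; move: g1.
have lAhB : last x A != head x B by apply: contraTneq hBB => <-; apply: dAB.
have lAx : last x A != x by apply/eqP => e; have := dAB _ lAA; move: nxlA; rewrite e => _ _;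
  move: uall; rewrite cat_uniq => /and3P[_ /hasPn H _]; have := H x;
    rewrite !mem_cat mem_head !orbT => /(_ isT) /=; rewrite -{1}e lAA.
have hBx : head x B != x by apply: contraNneq xB => <-.
have xhB : h x (head x B).
  have := hclaw g2 hv'hB v'x;
    rewrite /= !inE negb_or lAhB lAx hBx hsym (negPf g3) (hsym (last x A)) (negPf nxlA) /=.
  by rewrite hsym; apply.
have nuhB : near u (head x B).
  by case/orP: (nor' xhB) => // /orP[/eqP e|e]; [rewrite e eqxx in hBv|rewrite e in g4].
have v'lB : h v' (last x B).
  apply: near_adj_rev; rewrite // 1?hsym //; first by rewrite /near f4 orbT.
  apply: contraTneq lBB => <-; move: uall; rewrite cat_uniq => /and3P[_ _ /=].
  by rewrite mem_cat => /andP[/norP[]].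
have hBhR : h (head x B) (head x R).
  apply: nadj; rewrite // 1?hsym //.
  apply/eqP => e; have hR := head_in nR; move: uall; rewrite !catA cat_uniq => /and3P[_ /hasPn H _].
  by have := H _ hR; rewrite /= -e !mem_cat hBB !orbT.
have lR : last x R = u by rewrite -lp ep !wE //; nz.
have gt := open_gt0 op; have [tp _ _ _ _] := op.1.
have pq : perm_eq (A ++ [:: v'] ++ rev B ++ R ++ [:: x]) p by rewrite ep; plia.
apply: (improve tp pq); rewrite ep; calc.
rewrite hA lR /= (edge_cost0 v'lB) (edge_cost0 hBhR) (edge_cost0 xv) (edge_costC u) (edge_cost0 xu).
by move: gt; clear; lia.
Qed.
End Crossing.

Lemma half_side p u v z : open_at p u v -> h x z -> near u z ->
  forall w, h x w -> ~~ h w z -> w != z -> w != v -> h w v.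
Proof.
move=> op xz nz' w xw hw wz wv; case/orP: (near_or op xw) => [nw|/orP[/eqP e|//]].
  by case/negP: hw; apply: (near_adj op).
by rewrite e eqxx in wv.
Qed.

(** By [half_hub] at [z] and [hub] at [x], the segment between [z] and [x] fits between [u] and [v],
    and [swap] applies. *)
Lemma before_center p u v z A1 A2 B : open_at p u v -> p = A1 ++ [:: z] ++ A2 ++ [:: x] ++ B ->
  h x z -> h z u -> ~~ near v z -> (forall q, open_at q z v -> False) -> False.
Proof.
move=> op ep xz zu; rewrite /near negb_or => /andP[zv hzv] noz; have [[_ _ _ xu xv] _] := op.
have ne a1 a2 : h a1 a2 -> a1 != a2 by apply: contraTneq => ->; rewrite hirr.
have [nA1 nR] := open_inner op ep (ne _ _ zu) zv.
have epx : p = (A1 ++ [:: z] ++ A2) ++ [:: x] ++ B by rewrite ep -!catA.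
have [nL nB] := open_inner op epx (ne _ _ xu) (ne _ _ xv).
have [_ [_ _ _ f4 _]] := hub op epx nL nB (introT orP (or_introl (eqxx x))) xu xv.
have nz' : near u z by rewrite /near zu orbT.
have [_ _ _ _ f5] := half_hub op ep nA1 nR xz zu zv hzv noz (half_side op xz nz').
have nA2 : A2 != [::].
  by apply/negP => /eqP e; move: f4; rewrite e cats0 !wE // /= (negPf zv) (negPf hzv).
apply: (swap op ep nA1 nA2 nB); [by rewrite hsym|by move: f5; rewrite !wE|].
by move: f4; rewrite !wE //; nz.
Qed.

(** Appending a missing [z] costs nothing for [u z] and at most 1 for [z v], so the longer sequence
    is again minimal and is open at [z] and [v]. *)
Lemma open_mem p u v z : open_at p u v -> h x z -> h z u -> ~~ near v z ->
  (forall q, open_at q z v -> False) -> z \in p.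
Proof.
move=> op xz zu; rewrite /near negb_or => /andP[zv hzv] noz; have gt := open_gt0 op.
have [[tp hp lp xu xv] _] := op; apply: contraT => zp; exfalso.
have pn : p != [::] by apply: contraTneq xu => e; rewrite -lp e hirr.
have uq : uniq (p ++ [:: z]) by rewrite cat_uniq (proj1 tp) /= orbF zp.
have sq : {subset p <= p ++ [:: z]} by move=> y; rewrite mem_cat => ->.
apply: (noz (p ++ [:: z])); split=> //; split=> //; last 1 first.
- by rewrite !wE.
- apply: (tight_le tp uq sq); calc.
  rewrite hp lp /= (edge_costC u z) (edge_cost0 zu).
  by have := edge_cost1 xz xv zv; move: gt; clear; lia.
- by rewrite !wE.
Qed.

(** By [before_center], [v'] precedes [x] and [u'] follows it. The two reordered halves, joined at
    [x] and closed by the crossing edge [u' v'], avoid the pair [u v] and are cheaper. *)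
Lemma no_open p u v : open_at p u v -> False.
Proof.
move=> op; have [u' [v' [xu' xv' nu' nv' uv']]] := crossing op.
have opr := open_rev op; have [[_ _ _ xu xv] [uv huv]] := op.
have nvu' : ~~ near v u' by apply/negP => /(near_excl op xu' nu').
have nuv' : ~~ near u v' by apply/negP => H; apply: (near_excl op xv' H nv').
have u'u : u' != u by apply: contraNneq nuv' => <-; rewrite /near hsym uv' orbT.
have v'v : v' != v by apply: contraNneq nvu' => <-; rewrite /near uv' orbT.
have hu'u : h u' u by case/orP: nu' => // /eqP e; rewrite e eqxx in u'u.
have hv'v : h v' v by case/orP: nv' => // /eqP e; rewrite e eqxx in v'v.
(* If [u'] could replace [u], then [v'] would be a common neighbour of the closing pair. *)
have nou q : open_at q u' v -> False by move=> o; apply: (open_common o xv'); rewrite // hsym.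
have nov q : open_at q v' u -> False by move=> o; apply: (open_common o xu').
have u'p := open_mem op xu' hu'u nvu' nou.
have := open_mem opr xv' hv'v nuv' nov; rewrite mem_rev => v'p.
have xp : x \in p by apply: contraT => xp; have := open_superset op xp xu xv.
have [A [B ep]] := split_at xp.
have nx w : h x w -> w != x by apply: contraTneq => ->; rewrite hirr.
move: u'p v'p; rewrite ep !mem_cat !inE (negPf (nx _ xu')) (negPf (nx _ xv')) /=.
case/orP=> /split_at[C1 [C2 eC]].
  by move=> _; apply: (before_center op (A1 := C1) (A2 := C2) (B := B)) xu' hu'u nvu' nou;
    rewrite ep eC -!catA.
case/orP=> /split_at[D1 [D2 eD]]; last first.
  apply: (before_center opr (A1 := rev D2) (A2 := rev D1) (B := rev A)) xv' hv'v nuv' nov.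
  by rewrite ep eD !rev_cat -!catA.
have e1 : p = D1 ++ [:: v'] ++ D2 ++ [:: x] ++ B by rewrite ep eD -!catA.
have e2 : rev p = rev C2 ++ [:: u'] ++ rev C1 ++ [:: x] ++ rev A.
  by rewrite ep eC !rev_cat -!catA.
have nB : B != [::] by rewrite eC; nz.
have nA : A != [::] by rewrite eD; nz.
have v'u : v' != u by apply: contraNneq nuv' => ->; rewrite /near eqxx.
have u'v : u' != v by apply: contraNneq nvu' => ->; rewrite /near eqxx.
have [nD1 _] := open_inner op e1 v'u v'v.
have [nC2 _] := open_inner opr e2 u'v u'u.
have nrA : rev A != [::] by nz.
have [Q1 [pQ1 nQ1 hQ1 lQ1 wQ1]] := half_path op e1 nD1 nB xv' nv' v'v nov.
have [Q2 [pQ2 nQ2 hQ2 lQ2 wQ2]] := half_path opr e2 nC2 nrA xu' nu' u'u nou.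
have gt := open_gt0 op; have [[tp hp lp _ _] _] := op.
have pq : perm_eq (Q1 ++ [:: x] ++ rev Q2) p.
  rewrite e1; move/permP: pQ1 => pQ1; move/permP: pQ2 => pQ2; apply/permP => y.
  have := pQ1 y; have := pQ2 y; rewrite eC !(count_cat, count_rev) /=; clear; lia.
apply: (improve tp pq).
have -> : cst p = wt A + edge_cost (last x A) x + edge_cost x (head x B) + wt B + edge_cost u v.
  exact: (cost_split op ep nA nB).
calc; rewrite hQ1 hQ2 /= (edge_cost0 uv') (edge_cost0 lQ2) (edge_costC _ x) (edge_cost0 lQ1).
have wA : wt Q1 <= wt A by rewrite eD.
have wB : wt Q2 <= wt B by rewrite -(weight_rev x edge_costC B) eC !rev_cat -catA.
by move: wA wB gt; clear; lia.
Qed.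

Lemma path_weight y s : path h1 y s -> wt (y :: s) <= size s.
Proof.
elim: s y => // z s IH y /andP[yz /IH le].
have d1 : edge_cost y z <= 1 by rewrite /edge_cost yz; case: (h y z).
exact: (leq_add d1 le).
Qed.

Lemma weight0_path y s : wt (y :: s) = 0 -> path h y s.
Proof.
elim: s y => //= z s IH y /eqP; rewrite addn_eq0 => /andP[e /eqP/IH->]; rewrite andbT.
by apply: contraT; rewrite -edge_cost_gt0 (eqP e).
Qed.

(** The least cost over all supersets of [s] is at most [#|T|], so a minimal closed sequence has no
    pair outside the completion. A pair of cost 1 could be rotated to the closing position, against
    [no_open]. *)
Lemma completion_cycle s : uniq s -> 2 < size s -> cycle h1 s ->
  exists s', [/\ uniq s', 2 < size s', cycle h s' & {subset s <= s'}].
Proof.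
move=> us sz cs.
have le_card (q : seq T) : uniq q -> size q <= #|T| by move=> uq; rewrite -(card_uniqP uq);
  apply: max_card.
have cs1 : cst s <= #|T|.
  apply: leq_trans (le_card _ us); case: (s) cs sz => //= y r; rewrite rcons_path => /andP[pr lr] _.
  have d1 : edge_cost (last y r) y <= 1 by rewrite /edge_cost lr; case: (h _ y).
  by rewrite -addn1; apply: leq_add (path_weight pr) d1.
(* A sequence without repetition has at most [#|T|] terms, so the minimum is taken over a finite
   type. *)
pose P := [pred q : {bseq #|T| of T} | uniq q && all (mem q) s].
have Ps : P (Bseq (le_card _ us)) by rewrite /= us /=; apply/allP.
have [p0 /andP[up0 /allP sp0] pmin0] := arg_minnP (fun q : {bseq #|T| of T} => cst q) Ps.
have [p [up sp pmin]] : exists p, [/\ uniq p, {subset s <= p} & forall q : {bseq #|T| of T},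
  P q -> cst p <= cst q].
  by exists p0.
have tp : tight p.
  split=> // q uq sq; apply: (pmin (Bseq (le_card _ uq))); rewrite /= uq /=.
  by apply/allP => y ys; apply: sq; apply: sp.
have cp : cst p <= #|T| by apply: leq_trans cs1; apply: (pmin (Bseq (le_card _ us))).
have szp : 2 < size p by apply: leq_trans sz _; apply: uniq_leq_size.
exists p; split=> //.
have [c0|] := posnP (cst p); last first.
  move=> /cost_gt0[q [pq cq gt]]; exfalso.
  have tq : tight q by apply: (tight_le tp); rewrite ?(perm_uniq pq) ?cq // => y;
    rewrite (perm_mem pq).
  have lt : edge_cost (last x q) (head x q) <= #|T|.
    by apply: leq_trans cp; rewrite -cq /cost leq_addl.
  move: (gt) lt; rewrite edge_cost_gt0 {1}/edge_cost => /negPf nh; rewrite nh.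
  case: ifP => [|_]; last by rewrite ltnn.
  rewrite /completion nh /= => /and3P[ne xl xh] _.
  by apply: (@no_open q (last x q) (head x q)); split; split; rewrite ?nh.
case: (p) szp c0 => // y r _ /eqP; rewrite /cost addn_eq0 => /andP[/eqP/weight0_path pr e].
rewrite /= rcons_path pr /=; apply: contraT; rewrite -edge_cost_gt0.
by move: e => /= /eqP ->.
Qed.
End Cycles.
End Completion.

(** * Theorems of Hall and Menger *)

Section Hall.
Variable X : finType.
Implicit Types (E : {set X * X}) (Z L : {set X}).

Definition image_of E Z : {set X} := [set y | [exists x in Z, (x, y) \in E]].

Definition hall_cond L E := [forall Z : {set X}, (Z \subset L) ==> (#|Z| <= #|image_of E Z|)].

(* Rado's argument: in a minimal relation satisfying Hall's condition every point of L has only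
   one image. *)
Lemma hall L E : hall_cond L E ->
  exists f : X -> X, {in L, forall x, (x, f x) \in E} /\ {in L &, injective f}.
Proof.
move=> hE; have [E' /minsetP[hE' Emin] sE] := minset_exists hE.
have H Z : Z \subset L -> #|Z| <= #|image_of E' Z|.
  by move=> sZ; move/forallP/(_ Z)/implyP: hE'; apply.
have del x y : (x, y) \in E' ->
  exists Z, [/\ Z \subset L, x \in Z & #|image_of (E' :\ (x, y)) Z| < #|Z|].
  move=> xy; have: ~~ hall_cond L (E' :\ (x, y)).
    apply/negP => h; have := Emin _ h (subD1set _ _).
    by move/setP/(_ (x, y)); rewrite xy !inE eqxx.
  rewrite negb_forall => /existsP[Z]; rewrite negb_imply -ltnNge => /andP[sZ lt].
  exists Z; split=> //; apply: contraLR lt => nx; rewrite -leqNgt (leq_trans (H _ sZ)) //.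
  apply/subset_leq_card/subsetP => w; rewrite !inE => /existsP[v /andP[vZ vw]].
  apply/existsP; exists v; rewrite vZ !inE vw andbT /=.
  by apply: contraNneq nx => -[<-].
have one x y1 y2 : (x, y1) \in E' -> (x, y2) \in E' -> y1 = y2.
  move=> h1 h2; apply/eqP/negP => /negP ne.
  have [Z1 [s1 x1 c1]] := del _ _ h1; have [Z2 [s2 x2 c2]] := del _ _ h2.
  set A1 := image_of _ Z1 in c1; set A2 := image_of _ Z2 in c2.
  have sU : Z1 :|: Z2 \subset L by rewrite subUset s1.
  have sI : Z1 :&: Z2 :\ x \subset L.
    by apply: subset_trans (subD1set _ _) _; apply: subset_trans (subsetIl _ _) s1.
  have cU : #|Z1 :|: Z2| <= #|A1 :|: A2|.
    apply: leq_trans (H _ sU) (subset_leq_card _).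
    apply/subsetP => w; rewrite !inE => /existsP[v /andP[]]; rewrite !inE => vZ vw.
    have [E1|n1] := eqVneq (v, w) (x, y1).
      apply/orP; right; apply/existsP; exists x; rewrite x2 !inE.
      by case: E1 vw => -> -> ->; rewrite xpair_eqE negb_and ne orbT.
    have [E2|n2] := eqVneq (v, w) (x, y2).
      apply/orP; left; apply/existsP; exists x; rewrite x1 !inE.
      by case: E2 vw => -> -> ->; rewrite xpair_eqE negb_and eq_sym ne orbT.
    by case/orP: vZ => vZ; apply/orP; [left|right]; apply/existsP; exists v;
      rewrite vZ !inE ?n1 ?n2.
  have cI : #|Z1 :&: Z2 :\ x| <= #|A1 :&: A2|.
    apply: leq_trans (H _ sI) (subset_leq_card _).
    apply/subsetP => w; rewrite !inE => /existsP[v /andP[]]; rewrite !inE => /and3P[nvx v1 v2] vw.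
    by apply/andP; split; apply/existsP; exists v; rewrite ?v1 ?v2 !inE xpair_eqE negb_and nvx.
  have := cardsUI A1 A2; have := cardsUI Z1 Z2.
  have := cardsD1 x (Z1 :&: Z2); rewrite inE x1 x2 /=.
  move: c1 c2 cU cI; rewrite -/A1 -/A2; lia.
have ex x : x \in L -> exists y, (x, y) \in E'.
  move=> xL; have /card_gt0P[y] : 0 < #|image_of E' [set x]|.
    by apply: leq_trans (H _ _); rewrite ?cards1 ?sub1set.
  by rewrite inE => /existsP[v /andP[/set1P-> ?]]; exists y.
exists (fun x => odflt x [pick y | (x, y) \in E']);
  have hf x : x \in L -> (x, odflt x [pick y | (x, y) \in E']) \in E'.
  by move=> /ex[y xy]; case: pickP => [//|/(_ y)]; rewrite xy.
split=> [x xL|x x' xL xL' /= ff]; first by apply: (subsetP sE); apply: hf.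
apply/eqP/negP => /negP ne; have := H [set x; x'].
rewrite cards2 ne subUset !sub1set xL xL' => /(_ isT); apply/negP; rewrite -ltnNge.
apply: (@leq_ltn_trans #|[set odflt x [pick y | (x, y) \in E']]|); last by rewrite cards1.
apply/subset_leq_card/subsetP => w; rewrite !inE => /existsP[v /andP[]];
  rewrite !inE => /orP[]/eqP-> vw.
  by rewrite (one _ _ _ vw (hf _ xL)).
by rewrite ff (one _ _ _ vw (hf _ xL')).
Qed.
End Hall.

Section Menger.
Variables (X : finType) (r : rel X) (A B : {set X}).

(** If [Z] misses [B], then [outer Z] and the points of [A] outside [Z] together separate [A] from
    [B]; the hypothesis [cut] says that such a separator has at least [#|A|] points. *)
Definition outer (Z : {set X}) : {set X} :=
  [set w | [&& w \notin Z, w \notin A & [exists v in Z, r v w]]].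

Hypothesis cut : forall Z : {set X}, [disjoint Z & B] -> #|A :&: Z| <= #|outer Z|.

(* A matching of ~: B into ~: A along r or the diagonal; its orbits from A are the paths. *)
Lemma menger_matching : exists f : X -> X,
  [/\ {in ~: B, forall x, (f x == x) || r x (f x)}, {in ~: B, forall x, f x \notin A}
    & {in ~: B &, injective f}].
Proof.
pose E := [set p : X * X | (p.2 \notin A) && ((p.2 == p.1) || r p.1 p.2)].
have /hall[f [fE fI]] : hall_cond (~: B) E.
  apply/forallP => Z; apply/implyP => sZ.
  have dZ : [disjoint Z & B] by rewrite disjoints_subset.
  have -> : image_of E Z = outer Z :|: (Z :\: A).
    apply/setP => w; rewrite !inE; apply/existsP/idP.
      case=> v; rewrite inE => /= /and3P[vZ -> /orP[/eqP->|vw]]; first by rewrite vZ.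
      by case: (w \in Z); rewrite ?orbT //= orbF; apply/existsP; exists v; rewrite vZ.
    case/orP=> [/and3P[_ wA /existsP[v /andP[vZ vw]]]|/andP[wA wZ]].
      by exists v; rewrite inE /= vZ wA vw orbT.
    by exists w; rewrite inE /= wZ wA eqxx.
  rewrite cardsU; have -> : outer Z :&: (Z :\: A) = set0.
    by apply/setP => w; rewrite !inE; case: (w \in Z); rewrite //= ?andbF.
  by rewrite cards0 subn0 -(cardsID A Z) leq_add2r setIC cut.
exists f; split=> // x xB; have := fE _ xB; rewrite inE => /andP[] //.
Qed.

(** The matching is injective and its values avoid [A], so orbits starting in [A] neither merge nor
    repeat a point; by finiteness each of them reaches [B]. *)
Lemma menger : exists P : X -> seq X,
  [/\ {in A, forall a, path r a (P a) && (last a (P a) \in B)},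
      {in A, forall a, uniq (a :: P a)} &
      {in A &, forall a b x, x \in a :: P a -> x \in b :: P b -> a = b}].
Proof.
have [f [fr fA fI]] := menger_matching.
have cancel_iter i a b : (forall k, k < i -> iter k f a \notin B) -> (forall k, k < i ->
  iter k f b \notin B) ->
    iter i f a = iter i f b -> a = b.
  elim: i => //= i IH ha hb e; apply: IH => [k ki|k ki|]; try by [apply: ha; lia|apply: hb; lia].
  by apply: fI => //; rewrite inE ?ha ?hb.
have cancel2 i j a b : a \in A -> b \in A -> (forall k, k < i -> iter k f a \notin B) ->
    (forall k, k < j -> iter k f b \notin B) -> iter i f a = iter j f b -> a = b /\ i = j.
  wlog ij : i j a b / i <= j.
    by move=> W aA bA ha hb e; case: (leqP i j) => [|/ltnW] le; [|case: (W j i b a) => //];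
      apply: W.
  move=> aA bA ha hb; rewrite -(subnKC ij) iterD => /cancel_iter E.
  have {}E : a = iter (j - i) f b.
    by apply: E => // k ki; rewrite -iterD; apply: hb; lia.
  case: (posnP (j - i)) E => [e E|]; first by split; [rewrite E e|lia].
  case e: (j - i) => [//|k] _ E; exfalso; move: aA; rewrite E /=.
  by apply/negP/fA; rewrite inE; apply: hb; lia.
have reach a : a \in A -> exists n, iter n f a \in B.
  move=> aA; case: (boolP [exists i : 'I_#|X|.+1, iter i f a \in B]) => [/existsP[i]|];
    first by exists i.
  rewrite negb_exists => /forallP hB; exfalso.
  have inj : injective (fun i : 'I_#|X|.+1 => iter i f a).
    move=> i j /(cancel2 _ _ _ _ aA aA)[||_ /val_inj] // k kl.
      by have := hB (Ordinal (ltn_trans kl (ltn_ord i))).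
    by have := hB (Ordinal (ltn_trans kl (ltn_ord j))).
  by have := leq_card _ inj; rewrite card_ord ltnn.
have [n nP] : exists n : X -> nat, forall a, a \in A ->
    iter (n a) f a \in B /\ forall k, k < n a -> iter k f a \notin B.
  apply: (@fin_all_exists X (fun=> nat) (fun a m => a \in A ->
    iter m f a \in B /\ forall k, k < m -> iter k f a \notin B)) => a.
  case: (boolP (a \in A)) => [aA|_]; last by exists 0.
  exists (ex_minn (reach a aA)) => _; case: ex_minnP => m mB mmin; split=> // k kl.
  by apply/negP => /mmin; lia.
exists (fun a => traject f (f a) (n a)).
have memP a x : x \in a :: traject f (f a) (n a) -> exists2 i, i <= n a & x = iter i f a.
  by rewrite -trajectS => /trajectP[i il ->]; exists i.
split.
- move=> a aA; have [nB nn] := nP _ aA.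
  rewrite last_traject nB andbT.
  have: forall m k, k + m <= n a -> path r (iter k f a) (traject f (iter k.+1 f a) m).
    elim=> //= m IH k km; rewrite (IH k.+1) ?andbT; last lia.
    have kB : iter k f a \in ~: B by rewrite inE nn //; lia.
    (* A fixed point would repeat a point of the orbit, so consecutive iterates are joined by
       [r]. *)
    have := fr _ kB; case/orP => // /eqP e.
    have [_] : a = a /\ k.+1 = k by apply: (cancel2 k.+1 k) => // i ?; apply: nn; lia.
    lia.
  by move/(_ (n a) 0); apply; lia.
- move=> a aA; have [nB nn] := nP _ aA; rewrite -trajectS; apply/(uniqP a) => i j.
  rewrite !inE !size_traject => il jl; rewrite !nth_traject // => e.
  by case: (cancel2 i j a a) => // k kl; apply: nn; lia.
- move=> a b aA bA x /memP[i il ->] /memP[j jl] e.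
  by case: (cancel2 i j a b) => // k kl; [case: (nP _ aA)|case: (nP _ bA)] => _; apply; lia.
Qed.
End Menger.

(** * Fans and blocked legs *)

Section Fan.
Variables (T I J : finType) (h : rel T) (W : {set T}) (S : I -> {set T}) (K : J -> {set T}).

(* One token per source and per sink, so that disjoint paths use distinct sources and sinks. *)
Definition fan_rel : rel (T + I + J) := fun x y => match x, y with
  | inl (inl a), inl (inl b) => [&& a \in W, b \in W & h a b]
  | inl (inr i), inl (inl b) => (b \in W) && [exists a in S i, h a b]
  | inl (inl a), inr j => (a \in W) && (a \in K j)
  | inl (inr i), inr j => [exists a in S i, a \in K j]
  | _, _ => false
  end.

Definition fan_src : {set T + I + J} := [set inl (inr i) | i : I].
Definition fan_snk : {set T + I + J} := [set inr j | j : J].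

(** The start [a i] only witnesses the first edge of a path and is not counted among its vertices,
    so different paths may share it. *)
Lemma fan : (forall Z : {set T + I + J}, [disjoint Z & fan_snk] ->
  #|fan_src :&: Z| <= #|outer fan_rel fan_src Z|) ->
  exists (s : I -> J) (a : I -> T) (p : I -> seq T),
  [/\ injective s, forall i, a i \in S i,
      forall i, [/\ path h (a i) (p i), last (a i) (p i) \in K (s i),
        {subset p i <= W} & uniq (p i)] &
      forall i k x, x \in p i -> x \in p k -> i = k].
Proof.
move=> /menger[P [Ppath Puniq Pdis]].
have dec a s : path fan_rel (inl (inl a)) s -> last (inl (inl a)) s \in fan_snk ->
    exists p j, [/\ s = [seq inl (inl b) | b <- p] ++ [:: inr j], path h a p,
      last a p \in K j & {subset p <= W}].
  elim: s a => [|[[b|i]|j] s IH] a //=; first by move=> _ /imsetP[].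
    case/andP=> /and3P[_ bW ab] /IH{}IH /IH[p [j [-> pp lp sp]]].
    by exists (b :: p), j; rewrite /= ab; split=> // x; rewrite inE => /predU1P[->|/sp].
  case/andP=> /andP[_ aK]; case: s {IH} => [|[[]|] s] //= _ _.
  by exists [::], j.
have key i : exists t : J * T * seq T, let: (j, a, p) := t in
    [/\ P (inl (inr i)) = [seq inl (inl b) | b <- p] ++ [:: inr j], a \in S i, path h a p,
      last a p \in K j & {subset p <= W}].
  have si : inl (inr i) \in fan_src by apply: imset_f.
  have /andP[] := Ppath _ si; case: (P _) => [|[[b|k]|j] s] //=; first by move=> _ /imsetP[].
    case/andP=> /andP[bW /existsP[a /andP[aS ab]]] /dec{}dec /dec[p [j [-> pp lp sp]]].
    exists (j, a, b :: p); rewrite /= ab; split=> // x.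
    by rewrite inE => /predU1P[->|/sp].
  case/andP=> /existsP[a /andP[aS aK]]; case: s => [|[[]|] s] //= _ _.
  by exists (j, a, [::]).
have [t tP] := fin_all_exists key.
exists (fun i => (t i).1.1), (fun i => (t i).1.2), (fun i => (t i).2).
have inj i k x : x \in P (inl (inr i)) -> x \in P (inl (inr k)) -> i = k.
  move=> xi xk; have := Pdis (inl (inr i)) (inl (inr k)).
  rewrite !imset_f // => /(_ isT isT x); rewrite !inE xi xk !orbT => /(_ isT isT).
  by case.
split.
- move=> i k; have := tP i; have := tP k; case: (t i) (t k) => [[j a] p] [[j' a'] p'] /=.
  move=> [Pk _ _ _ _] [Pi _ _ _ _] e; apply: (inj _ _ (inr j)).
    by rewrite Pi mem_cat !inE eqxx orbT.
  by rewrite Pk e mem_cat !inE eqxx orbT.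
- by move=> i; have := tP i; case: (t i) => [[j a] p] [].
- move=> i; have := tP i; case: (t i) => [[j a] p] /= [Pi _ ? ? ?]; split=> //.
  have := Puniq (inl (inr i)) (imset_f _ isT); rewrite Pi /= cat_uniq.
  by case/and4P=> _ + _ _; rewrite map_inj_uniq // => x y [].
- move=> i k x; have := tP i; have := tP k; case: (t i) (t k) => [[j a] p] [[j' a'] p'] /=.
  move=> [Pk _ _ _ _] [Pi _ _ _ _] xi xk; apply: (inj _ _ (inl (inl x))).
    by rewrite Pi mem_cat map_f.
  by rewrite Pk mem_cat map_f.
Qed.
End Fan.

Lemma exit_outer (X : finType) (r : rel X) (A Z : {set X}) x s :
  path r x s -> x \in Z -> last x s \notin Z -> all (fun y => y \notin A) s ->
  exists2 y, y \in s & y \in outer r A Z.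
Proof.
elim: s x => [|y s IH] x /=; first by move=> _ ->.
case/andP=> xy ps xZ lZ /andP[yA sA].
have [yZ|yZ] := boolP (y \in Z).
  by have [w ws wo] := IH y ps yZ lZ sA; exists w => //; rewrite inE ws orbT.
exists y; first exact: mem_head.
by rewrite inE yZ yA; apply/existsP; exists x; rewrite xZ.
Qed.

(** Bookkeeping for a set that violates the cut condition: [b0] and [b1] stand for its containing
    the sources at the two ends, [b2] for the source in the middle, and [o] counts its outer
    points. *)
Lemma cut_count (b0 b1 b2 : bool) (o c : nat) : c <= b0 + b1 + b2 -> o < c ->
  (b0 -> 0 < o) -> (b1 -> 0 < o) -> (b2 || b0 && b1 -> 1 < o) -> [/\ b2, b0 & b1].
Proof.
by case: b0; case: b1; case: b2 => //= cb oc h0 h1 h2; exfalso;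
  try have := h0 isT; try have := h1 isT; try have := h2 isT; lia.
Qed.

Section Blocked.
Variables (T : finType) (h : rel T).
Hypothesis (hsym : symmetric h).

(** At most two vertices of the leg [g] cut [X] off from the rest [R] of the frame. *)
Definition blocked (g : seq T) (R : {set T}) : Prop := exists X Y : {set T},
  [/\ X != set0, [disjoint X & R], Y \subset g, #|Y| <= 2 &
      forall a b, a \in X -> h a b -> b \in X :|: Y].

Lemma linked_mid C p q r D : linked h C (p ++ q :: r) D ->
  [/\ path h q (rev p), last q (rev p) \in C, path h q r & last q r \in D].
Proof.
case: p => [|x p] /=; first by case/and3P.
rewrite cat_path last_cat /= => /and3P[xC /and3P[px xq qr] ->].
have := rev_path h x (rcons p q); rewrite last_rcons belast_rcons.
rewrite (eq_path (e' := h)) => [->|u v]; last by rewrite hsym.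
by rewrite rcons_path px xq rev_cons last_rcons xC qr.
Qed.

Section Leg.
Variables (C D R : {set T}) (p1 p2 m : seq T) (y : T).
Let g := p1 ++ (y :: m) ++ p2.
Let z := last y m.
Hypotheses (lg : linked h C g D) (ug : uniq g) (gR : all (fun x => x \notin R) g).

(** In the application [y] and [z] are the first and the last special of the leg; the third path may
    start anywhere from [y] to [z]. *)
Definition leg_src (i : option bool) : {set T} :=
  match i with Some true => [set y] | Some false => [set z] | None => [set x in y :: m] end.

Definition leg_snk (j : option bool) : {set T} :=
  match j with Some true => C | Some false => D | None => [set a | [exists b in R, h a b]] end.

Definition leg_free : {set T} := [set x | (x \notin R) && (x \notin y :: m)].

Let fr := fan_rel h leg_free leg_src leg_snk.
Let fs : {set T + option bool + option bool} := fan_src T (option bool) (option bool).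
Let fk : {set T + option bool + option bool} := fan_snk T (option bool) (option bool).

Lemma fan_path i j a p : a \in leg_src i -> path h a p -> last a p \in leg_snk j ->
  {subset p <= leg_free} ->
  path fr (inl (inr i)) ([seq inl (inl b) | b <- p] ++ [:: inr j]).
Proof.
have key b q : b \in leg_free -> path h b q -> last b q \in leg_snk j -> {subset q <= leg_free} ->
    path fr (inl (inl b)) ([seq inl (inl b) | b <- q] ++ [:: inr j]).
  elim: q b => [|c q IH] b bW /=; first by move=> _ -> _; rewrite bW.
  case/andP=> -> pq lq sq; rewrite bW sq ?mem_head //= IH ?sq ?mem_head //.
  by move=> x xq; rewrite sq // inE xq orbT.
move=> aS; case: p => [|b q] /= => [_ aK _|/andP[ab pq] lq sq].
  by rewrite andbT; apply/existsP; exists a; rewrite aS.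
rewrite sq ?mem_head //= key ?sq ?mem_head // ?andbT.
  by apply/existsP; exists a; rewrite aS.
by move=> x xq; rewrite sq // inE xq orbT.
Qed.

Lemma leg_ends : [/\ path h y (rev p1), last y (rev p1) \in C, path h z p2 & last z p2 \in D].
Proof.
have := lg; rewrite /g /= => /linked_mid[-> -> _ _].
have := lg; rewrite /g lastI -cats1 -!catA catA => /linked_mid[_ _ -> ->] //.
Qed.

Lemma p1_free : {subset rev p1 <= leg_free}.
Proof.
move=> x; rewrite mem_rev inE => xp; move/allP: gR => /(_ x) -> /=; last by rewrite mem_cat xp.
move: ug; rewrite /g cat_uniq => /and3P[_ /hasPn H _]; apply: contraL xp => xm.
by apply: H; rewrite mem_cat xm.
Qed.

Lemma p2_free : {subset p2 <= leg_free}.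
Proof.
move=> x xp; rewrite inE; move/allP: gR => /(_ x) -> /=; last by rewrite !mem_cat xp !orbT.
move: ug; rewrite /g catA cat_uniq => /and3P[_ /hasPn H _].
by have := H x xp; rewrite mem_cat negb_or => /andP[].
Qed.

(** The outer parts [p1] and [p2] of the leg are two disjoint ways out. Hence a violating set
    contains all three sources and has exactly two outer points, one on each way; those that are
    vertices rather than tokens form [Y]. *)
Lemma cut_blocked (Z : {set T + option bool + option bool}) : [disjoint Z & fk] ->
  #|outer fr fs Z| < #|fs :&: Z| -> blocked g R.
Proof.
move=> dZ ltZ; have [l1 l2 l3 l4] := leg_ends.
have snkZ j : inr j \notin Z.
  by apply/negP => H; move: dZ; rewrite disjoint_subset => /subsetP/(_ _ H); rewrite inE imset_f.
have exitp i j a p : inl (inr i) \in Z -> a \in leg_src i -> path h a p -> last a p \in leg_snk j ->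
    {subset p <= leg_free} ->
    exists2 w, w \in outer fr fs Z & w \in [seq inl (inl b) | b <- p] ++ [:: inr j].
  move=> iZ aS pp lp sp; have := fan_path aS pp lp sp.
  case/(@exit_outer _ _ fs Z) => //; first by rewrite last_cat snkZ.
    by rewrite all_cat /= andbT; apply/andP; split; [apply/allP => w /mapP[b _ ->]|];
       apply/negP => /imsetP[].
  by move=> w w1 w2; exists w.
have exL i : i != Some false -> inl (inr i) \in Z -> exists2 w, w \in outer fr fs Z &
    w \in [seq inl (inl b) | b <- rev p1] ++ [:: inr (Some true)].
  move=> iN iZ; apply: (@exitp i _ y) => //; last exact: p1_free.
  by case: i iN {iZ} => [[]|] //; rewrite !inE eqxx.
have exR i : i != Some true -> inl (inr i) \in Z -> exists2 w, w \in outer fr fs Z &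
    w \in [seq inl (inl b) | b <- p2] ++ [:: inr (Some false)].
  move=> iN iZ; apply: (@exitp i _ z) => //; last exact: p2_free.
  by case: i iN {iZ} => [[]|] //; rewrite !inE ?eqxx // /z -in_cons mem_last.
have LR w : w \in [seq inl (inl b) | b <- rev p1] ++ [:: inr (Some true)] ->
    w \in [seq inl (inl b) | b <- p2] ++ [:: inr (Some false)] -> False.
  rewrite !mem_cat !inE => /orP[/mapP[b bp ->]|/eqP->]; last by case/orP=> // /mapP[].
  case/orP=> // /mapP[c cp [e]]; subst c; move: ug; rewrite /g cat_uniq => /and3P[_ /hasPn H _].
  by have := H b; rewrite !mem_cat cp orbT -mem_rev bp => /(_ isT).
have cfs : #|fs :&: Z| <= (inl (inr (Some true)) \in Z) + (inl (inr (Some false)) \in Z) + (inl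
  (inr None) \in Z).
  have -> : fs = [set inl (inr (Some true))] :|: [set inl (inr (Some false))] :|: [set inl (inr
    None)].
    apply/setP => w; rewrite !inE; apply/imsetP/idP => [[[[]|] _ ->]|]; rewrite ?eqxx ?orbT //.
    by case/orP=> [/orP[]|] /eqP->; eexists.
  rewrite !setIUl; apply: leq_trans (leq_card_setU _ _) _.
  have c1 w : #|[set w] :&: Z| = (w \in Z).
    case: (boolP (w \in Z)) => wZ; first by rewrite (setIidPl _) ?sub1set // cards1.
    by apply: eq_card0 => v; rewrite !inE; case: eqP => // ->; rewrite (negPf wZ).
  by rewrite leq_add ?c1 // (leq_trans (leq_card_setU _ _)) // !c1.
have two w w' : w \in outer fr fs Z -> w' \in outer fr fs Z -> w != w' ->
    [set w; w'] \subset outer fr fs Z by move=> hw hw' _; rewrite subUset !sub1set hw.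
have o1 i : inl (inr i) \in Z -> 0 < #|outer fr fs Z|.
  move=> iZ; apply/card_gt0P; case: (eqVneq i (Some false)) => iN.
    by have [|w wo _] := exR i _ iZ; [rewrite iN|exists w].
  by have [w wo _] := exL i iN iZ; exists w.
have both : (inl (inr None) \in Z) || (inl (inr (Some true)) \in Z) && (inl (inr (Some false))
  \in Z) ->
    exists w w', [/\ w \in outer fr fs Z, w' \in outer fr fs Z, w != w',
    w \in [seq inl (inl b) | b <- rev p1] ++ [:: inr (Some true)] &
    w' \in [seq inl (inl b) | b <- p2] ++ [:: inr (Some false)]].
  move=> H; have [i iN iZ] : exists2 i, i != Some false & inl (inr i) \in Z.
    by case/orP: H => [?|/andP[? _]]; [exists None|exists (Some true)].
  have [j jN jZ] : exists2 i, i != Some true & inl (inr i) \in Z.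
    by case/orP: H => [?|/andP[_ ?]]; [exists None|exists (Some false)].
  have [w wo wl] := exL i iN iZ; have [w' wo' wl'] := exR j jN jZ.
  exists w, w'; split=> //; apply/eqP => e; apply: LR wl _; by rewrite e.
have both2 : (inl (inr None) \in Z) || (inl (inr (Some true)) \in Z) && (inl (inr (Some false))
  \in Z) ->
    1 < #|outer fr fs Z|.
  case/both=> w [w' [wo wo' ww' _ _]].
  by have := subset_leq_card (two _ _ wo wo' ww'); rewrite cards2 ww'.
have [N1 N2 N3] : [/\ inl (inr None) \in Z,
  inl (inr (Some true)) \in Z & inl (inr (Some false)) \in Z].
  exact: cut_count cfs ltZ (o1 _) (o1 _) both2.
have [w [w' [wo wo' ww' wl wl']]] := both ltac:(by rewrite N1).
have Oeq : outer fr fs Z = [set w; w'].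
  apply/eqP; rewrite eq_sym eqEcard two //= cards2 ww'.
  by move: cfs ltZ; rewrite N1 N2 N3 /= => cfs ltZ; rewrite -ltnS (leq_trans ltZ).
(* The token for [R] lies on neither way out, so no vertex of [X] has a neighbour in [R]. *)
have snkO : inr None \notin outer fr fs Z.
  rewrite Oeq !inE; apply/norP; split; apply/eqP => e.
    by move: wl; rewrite -e mem_cat !inE orbF => /mapP[].
  by move: wl'; rewrite -e mem_cat !inE orbF => /mapP[].
pose X := [set x in y :: m] :|: [set a in leg_free | inl (inl a) \in Z].
pose Y := [set a : T | inl (inl a) \in outer fr fs Z].
have fsN (x : T) : inl (inl x) \notin fs by apply/imsetP => -[].
have fsN' j : inr j \notin fs by apply/imsetP => -[].
have outI v u : v \in Z -> fr v u -> u \notin fs -> u \notin Z -> u \in outer fr fs Z.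
  by move=> vZ vu uF uZ; rewrite inE uZ uF; apply/existsP; exists v; rewrite vZ.
exists X, Y; split.
- by apply/set0Pn; exists y; rewrite !inE eqxx.
- rewrite disjoint_subset; apply/subsetP => x; rewrite !inE -in_cons => /orP[xm|/andP[/andP[]]] //.
  by move/allP: gR; apply; rewrite /g !mem_cat xm !orbT.
- apply/subsetP => a; rewrite inE Oeq !inE => /orP[]/eqP e.
    move: wl; rewrite -e mem_cat !inE orbF => /mapP[b bp [->]].
    by rewrite /g mem_cat -mem_rev bp.
  move: wl'; rewrite -e mem_cat !inE orbF => /mapP[b bp [->]].
  by rewrite /g !mem_cat bp !orbT.
- pose f (a : T) : T + option bool + option bool := inl (inl a).
  rewrite -(card_imset _ (_ : injective f)); last by move=> a b [].
  apply: leq_trans (_ : #|outer fr fs Z| <= 2); last by rewrite Oeq cards2; case: (_ != _).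
  by apply/subset_leq_card/subsetP => _ /imsetP[a + ->]; rewrite inE.
move=> a b aX ab.
have noR : b \notin R.
  apply/negP => bR; case/negP: snkO.
  have aK : a \in leg_snk None by rewrite inE; apply/existsP; exists b; rewrite bR.
  move: aX; rewrite inE => /orP[am|]; last first.
    rewrite inE => /andP[aW aZ]; apply: outI aZ _ _ _ => //.
    by rewrite /fr /= aW.
  by apply: outI N1 _ _ _ => //; apply/existsP; exists a; rewrite am.
case: (boolP (b \in y :: m)) => bm; first by rewrite !inE -in_cons bm.
have bW : b \in leg_free by rewrite inE noR bm.
case: (boolP (inl (inl b) \in Z)) => bZ.
  by rewrite inE; apply/orP; left; rewrite inE; apply/orP; right; rewrite inE bW.
rewrite inE; apply/orP; right; rewrite inE; move: aX; rewrite inE => /orP[am|].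
  by apply: outI N1 _ _ _ => //; rewrite /fr /= bW; apply/existsP; exists a; rewrite am.
by rewrite inE => /andP[aW aZ]; apply: outI aZ _ _ _ => //; rewrite /fr /= aW bW.
Qed.

Lemma fan_or_blocked : blocked g R \/
  exists (s : option bool -> option bool) (a : option bool -> T) (p : option bool -> seq T),
  [/\ injective s, forall i, a i \in leg_src i,
      forall i, [/\ path h (a i) (p i), last (a i) (p i) \in leg_snk (s i),
        {subset p i <= leg_free} & uniq (p i)] &
      forall i k x, x \in p i -> x \in p k -> i = k].
Proof.
case: (boolP [forall Z : {set T + option bool + option bool},
  [disjoint Z & fk] ==> (#|fs :&: Z| <= #|outer fr fs Z|)]).
  by move/forallP=> H; right; apply: fan => Z dZ; move/implyP: (H Z); apply.
rewrite negb_forall => /existsP[Z]; rewrite negb_imply -ltnNge => /andP[dZ lt].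
by left; apply: cut_blocked dZ lt.
Qed.
End Leg.
End Blocked.

(** * The search *)

Definition leg := (nat * nat * nat)%type.
(* (N, legs, req): the labels are the numbers below N, a leg (u, v, n) joins the labels u and v
   and carries n specials, and the labels in req must be visited. *)
Definition state := (nat * seq leg * seq nat)%type.

Fixpoint picks (X : Type) (s : seq X) : seq (X * seq X) :=
  if s is x :: s' then (x, s') :: [seq (q.1, x :: q.2) | q <- picks s'] else [::].

Definition heavy (g : leg) := g.2 != 0.

(** The Boolean says whether the trail is obliged to use the leg; the last number is the position of
    the leg in the state. *)
Definition dart := (nat * nat * bool * nat)%type.

Fixpoint incident (cur : nat) (pre legs : seq dart) : seq (nat * bool * nat * seq dart) :=
  if legs is g :: s then
    let: (u, v, h, i) := g in
    if eqn u cur then (v, h, i, catrev pre s) :: incident cur (g :: pre) s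
    else if eqn v cur then (u, h, i, catrev pre s) :: incident cur (g :: pre) s
    else incident cur (g :: pre) s
  else [::].

Fixpoint mem_nat (x : nat) (s : seq nat) :=
  if s is y :: s' then if eqn x y then true else mem_nat x s' else false.

(* A trail that has passed through cur does not use the third leg there, so it must use both
   other legs at the far end of that leg (collected in F) if that end is required. *)
Fixpoint leave (cur : nat) (legs : seq dart) : option (seq nat * seq dart) :=
  if legs is g :: s then
    let: (u, v, h, i) := g in
    if eqn u cur then if h then None else
       if leave cur s is Some (F, t) then Some (v :: F, t) else None
    else if eqn v cur then if h then None else
       if leave cur s is Some (F, t) then Some (u :: F, t) else None
    else if leave cur s is Some (F, t) then Some (F, g :: t) else None
  else Some ([::], [::]).

Definition force (req : seq nat) (F : seq nat) (legs : seq dart) : seq dart :=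
  foldr (fun x s => if mem_nat x req then
     [seq let: (u, v, h, i) := g in
        (u, v, if h then true else if eqn u x then true else eqn v x, i) | g <- s]
     else s) legs F.

(* A heuristic: its output is checked by closed_trail. *)
Fixpoint find_trail (fuel start cur : nat) (legs : seq dart) (req : seq nat) : option (seq nat) :=
  if (if eqn cur start then
        if req is [::] then ~~ has (fun g : dart => g.1.2) legs else false
      else false)
  then Some [::]
  else if fuel is k.+1 then
    let step c := let: (w, _, i, rest) := c in
       let r := if eqn cur start then Some ([::], rest) else leave cur rest in
       if r is Some (F, rest') then
         if find_trail k start w (force req F rest') [seq r <- req | ~~ eqn r w] is Some t then
           Some (i :: t) else None
       else None in
    let cand := incident cur [::] legs in
    if [seq c <- cand | c.1.1.2] is c :: _ then step c
    else (fix first cs :=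
            if cs is c :: cs' then if step c is Some t then Some t else first cs' else None) cand
  else None.

Fixpoint follow (legs : seq leg) (cur : nat) (t : seq nat) : option (seq nat) :=
  if t is i :: t' then
    let: (u, v, _) := nth (0, 0, 0) legs i in
    if eqn u cur then omap (cons v) (follow legs v t')
    else if eqn v cur then omap (cons u) (follow legs u t') else None
  else Some [::].

Definition closed_trail (legs : seq leg) (req : seq nat) (start : nat) (t : seq nat) : bool :=
  [&& uniq t, all (fun i => i < size legs) t,
     all (fun i => if heavy (nth (0, 0, 0) legs i) then mem_nat i t else true)
       (iota 0 (size legs)) &
     if follow legs start t is Some vs then
       (last start vs == start) && all (fun w => mem_nat w vs) req
     else false].

Fixpoint darts (i : nat) (legs : seq leg) : seq dart :=
  if legs is g :: s then (g.1, heavy g, i) :: darts i.+1 s else [::].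

(** In a cubic multigraph a closed trail visits no label twice, so [N] is enough fuel. It has to use
    every leg with specials, so it may be started at an end of one. *)
Definition good (st : state) : bool :=
  let: (N, legs, req) := st in
  if filter heavy legs is (u, _, _) :: _ then
    if find_trail N u u (darts 0 legs) req is Some t then closed_trail legs req u t else false
  else false.

(* The three arms of the centre of a fan lead to the two ends of the leg and to the landing leg. *)
Definition arms3 (x y z : nat) :=
  undup [:: (x, y, z); (x, z, y); (y, x, z); (y, z, x); (z, x, y); (z, y, x)].

(* The centre is the k-th special of the leg, or it lies between two specials. *)
Definition centers (n : nat) : seq ((nat * nat * nat) * bool) :=
  flatten [seq [seq (t, true) | t <- arms3 k (n - k.+1) 0] | k <- iota 0 n] ++
  flatten [seq [seq (t, false) | t <- arms3 k (n - k) 0] | k <- iota 1 n.-1].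

(* The third path lands between two specials of the leg, or at one of them. *)
Definition landings (m : nat) : seq ((nat * nat) * bool) :=
  [seq ((k, m - k), false) | k <- iota 0 m.+1] ++
  [seq ((k, m - k.+1), true) | k <- iota 0 m].

(** The new labels [N] and [N.+1] stand for the centre of the fan and for the landing point; a
    special found there leaves the legs and becomes a requirement. *)
Definition children (N : nat) (req : seq nat) (g : leg) (rest : seq leg) : seq state :=
  let: (u, v, n) := g in
  flatten [seq let: ((x, y, z), b) := c in
    flatten [seq let: ((a, b', m), rest') := q in
       [seq let: ((m1, m2), d) := l in
          (N.+2,
           [:: (u, N, x), (v, N, y), (N, N.+1, z), (a, N.+1, m1), (b', N.+1, m2) & rest'],
           nseq (nat_of_bool b) N ++ nseq (nat_of_bool d) N.+1 ++ req)
       | l <- landings m]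
     | q <- picks rest]
  | c <- centers n].

(** It is unknown which of the three legs can be refined, so the children of all three are listed.
    With fewer than three legs carrying specials nothing is guaranteed, and the state is kept. *)
Definition expand (st : state) : seq state :=
  let: (N, legs, req) := st in
  if filter heavy legs is g1 :: g2 :: g3 :: s then
    let r := s ++ filter (predC heavy) legs in
    children N req g1 (g2 :: g3 :: r) ++ children N req g2 (g1 :: g3 :: r)
     ++ children N req g3 (g1 :: g2 :: r)
  else [:: st].

(** * Canonical forms by colour refinement, and the exhaustive search *)

Fixpoint lexlt (s t : seq nat) : bool :=
  match s, t with
  | x :: s', y :: t' => if x < y then true else if x == y then lexlt s' t' else false
  | [::], _ :: _ => true
  | _, _ => false
  end.

Definition ranks (sg : seq (seq nat)) : seq nat :=
  [seq count (fun t => lexlt t x) sg | x <- sg].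

(** One round of colour refinement. A leg carries at most five specials, so the factor 6 packs the
    colour of the other end and the number of specials into one number. *)
Definition refine (N : nat) (legs : seq leg) (col : seq nat) : seq nat :=
  ranks [seq nth 0 col w ::
    sort leq (flatten [seq let: (u, v, n) := g in
        (if u == w then [:: nth 0 col v * 6 + n] else [::]) ++
        (if v == w then [:: nth 0 col u * 6 + n] else [::]) | g <- legs])
    | w <- iota 0 N].

(** Singles out one label of a repeated colour at a time, without backtracking. Colours are ranks,
    so a class of at least two labels leaves the next number free for its other members. *)
Fixpoint discretize (fuel N : nat) (legs : seq leg) (col : seq nat) : seq nat :=
  let col := refine N legs (refine N legs col) in
  if fuel is k.+1 then
    if [seq w <- iota 0 N | 1 < count (pred1 (nth 0 col w)) col] is w :: _ then
      let c := nth 0 col w in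
      discretize k N legs [seq let x := nth 0 col i in if (x == c) && (i != w) then x.+1 else x |
        i <- iota 0 N]
    else col
  else col.

Definition leg_le (g h : leg) : bool :=
  ~~ lexlt [:: h.2; h.1.1; h.1.2] [:: g.2; g.1.1; g.1.2].

Definition rename (col : seq nat) (g : leg) : leg :=
  let: (u, v, n) := g in
  let u' := nth 0 col u in let v' := nth 0 col v in
  if u' <= v' then (u', v', n) else (v', u', n).

(* A heuristic canonical form; soundness only uses that it relabels and sorts. *)
Definition norm (st : state) : state :=
  let: (N, legs, req) := st in
  let col := discretize N N legs [seq nat_of_bool (w \in req) | w <- iota 0 N] in
  if perm_eq col (iota 0 N) then
    (N, sort leg_le (map (rename col) legs), sort leq (map (nth 0 col) req))
  else st.

Definition dedup (L : seq state) : seq state :=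
  foldr (fun x acc => if x \in acc then acc else x :: acc) [::] L.

(** Success means that no state is left over: every branch has ended in a state accepted by
    [good]. *)
Fixpoint search (fuel : nat) (L : seq state) : bool :=
  if L is [::] then true else
  if fuel is k.+1 then
    search k (dedup [seq norm st | st <- flatten (map expand L) & ~~ good st])
  else false.

Definition theta (t : nat * nat * nat) : state :=
  (2, [:: (0, 1, t.1.1); (0, 1, t.1.2); (0, 1, t.2)], [::]).

(** Two to four specials on the cycle and one more on the ear, distributed over the three legs. *)
Definition triples : seq (nat * nat * nat) :=
  [seq t <- [seq (p, c) | p <- [seq (a, b) | a <- iota 0 6, b <- iota 0 6], c <- iota 0 6]
     | 2 < t.1.1 + t.1.2 + t.2 <= 5].

Definition roots : seq state := [seq st <- map theta triples | ~~ good st].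
Lemma search_roots : search 6 roots.
Proof. by vm_compute. Qed.

(** * Realizing frames *)

Lemma perm_map_lift (X Y : eqType) (f : X -> Y) (s : seq X) (t : seq Y) :
  perm_eq [seq f x | x <- s] t -> exists2 s', perm_eq s s' & [seq f x | x <- s'] = t.
Proof.
case: s => [|x0 s]; first by rewrite perm_sym => /perm_nilP ->; exists [::].
rewrite perm_sym => /(perm_iotaP (f x0))[Is pI ->].
exists [seq nth x0 (x0 :: s) i | i <- Is].
  rewrite perm_sym; apply/(perm_iotaP x0); exists Is => //.
  by rewrite (perm_trans pI) // size_map.
rewrite -map_comp; apply/eq_in_map => i;
  rewrite (perm_mem pI) mem_iota size_map add0n => /andP[_ ilt].
by rewrite [RHS](nth_map x0).
Qed.

Lemma mem_natE x s : mem_nat x s = (x \in s).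
Proof. by elim: s => //= y s ->; rewrite inE -[x == y]/(eqn x y); case: (eqn x y). Qed.

Section Realize.
Variables (T : finType) (h : rel T).
Hypotheses (hsym : symmetric h) (hirr : irreflexive h).
Hypotheses (hclaw : clawless h) (hdia : diamondless h).
Variable S : {set T}.

Definition frame := seq (leg * seq T).

Definition paths (F : frame) : seq T := flatten [seq f.2 | f <- F].

Definition leg_ok (N : nat) (C : nat -> {set T}) (U : {set T}) (f : leg * seq T) : bool :=
  [&& f.1.1.1 < N, f.1.1.2 < N, linked h (C f.1.1.1) f.2 (C f.1.1.2) & count (mem U) f.2 == f.1.2].

(* U is the set of specials carried by legs; the other specials lie in nodes of required labels. *)
Definition realizes (C : nat -> {set T}) (F : frame) (U : {set T}) (st : state) : Prop :=
  [/\ perm_eq [seq f.1 | f <- F] st.1.2, all (leg_ok st.1.1 C U) F,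
      forall w, w < st.1.1 -> isnode h (C w), uniq (paths F) &
      [/\ U \subset S, {subset U <= paths F} &
          forall s, s \in S -> s \notin U -> exists2 w, w \in st.2 & (w < st.1.1) && (s \in C w)]].

Definition real (st : state) : Prop := exists C F U, realizes C F U st.

Definition covered : Prop := exists c, [/\ uniq c, 2 < size c, cycle h c & {subset S <= c}].

Lemma perm_paths (F F' : frame) : perm_eq F F' -> perm_eq (paths F) (paths F').
Proof. by move=> pF; apply/perm_flatten/perm_map. Qed.

Lemma realizes_perm C F U N legs legs' req : realizes C F U (N, legs, req) -> perm_eq legs legs' ->
  exists F', [/\ realizes C F' U (N, legs', req), perm_eq F F' & [seq f.1 | f <- F'] = legs'].
Proof.
move=> [/= pF aF nC uF [US UF SU]] pl.
have [F' pFF' e] := perm_map_lift (perm_trans pF pl).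
exists F'; split=> //; split; rewrite /= ?e //; first by rewrite -(perm_all _ pFF').
  by rewrite -(perm_uniq (perm_paths pFF')).
by split=> // x /UF; rewrite (perm_mem (perm_paths pFF')).
Qed.

(** * From closed trails to cycles *)

Section Chain.
Variables (N : nat) (C : nat -> {set T}).
Hypothesis (nC : forall w, w < N -> isnode h (C w)).

Fixpoint chain (cur : nat) (tr : seq (seq T * nat)) : bool :=
  if tr is (p, v) :: tr' then [&& linked h (C cur) p (C v), v < N & chain v tr'] else true.

Definition chain_end (cur : nat) (tr : seq (seq T * nat)) := last cur [seq q.2 | q <- tr].
Definition chain_path (tr : seq (seq T * nat)) : seq T := flatten [seq q.1 | q <- tr].

Lemma chain_linked cur tr : chain cur tr -> uniq (chain_path tr) ->
  linked h (C cur) (chain_path tr) (C (chain_end cur tr)).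
Proof.
elim: tr cur => [|[p v] tr IH] cur /=; first by rewrite eqxx.
case/and3P=> lp vN ctr; rewrite /chain_path /= => u.
apply: (linked_cat hsym hdia (nC vN) u lp) => //; apply: IH => //.
by move: u; rewrite cat_uniq => /and3P[].
Qed.

(** The path [[:: s]] links the node of [w] to itself, so it can be inserted where the walk visits
    [w]. *)
Lemma chain_insert s w cur tr : chain cur tr -> w \in [seq q.2 | q <- tr] -> s \in C w ->
  exists tr', [/\ chain cur tr', chain_end cur tr' = chain_end cur tr,
    [seq q.2 | q <- tr'] =i [seq q.2 | q <- tr] & perm_eq (chain_path tr') (s :: chain_path tr)].
Proof.
elim: tr cur => [|[p v] tr IH] cur //= /and3P[lp vN ctr].
rewrite inE => /predU1P[->|wtr] sC.
  exists ((p, v) :: ([:: s], v) :: tr); split=> /=; rewrite ?lp ?vN ?sC //.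
    by move=> x; rewrite !inE orbA orbb.
  by apply/permP => a; rewrite /chain_path /= !count_cat /=; lia.
have [tr' [c1 c2 c3 c4]] := IH _ ctr wtr sC.
exists ((p, v) :: tr'); split=> /=; rewrite ?lp ?vN //.
  by move=> x; rewrite !inE c3.
move/permP: c4 => c4; apply/permP => a; have := c4 a.
by rewrite /chain_path /= !count_cat /= => ->; lia.
Qed.

Lemma chain_inserts E cur tr : chain cur tr ->
  {in E, forall s, exists2 w, w \in [seq q.2 | q <- tr] & s \in C w} ->
  exists tr', [/\ chain cur tr', chain_end cur tr' = chain_end cur tr &
    perm_eq (chain_path tr') (E ++ chain_path tr)].
Proof.
move=> ctr hE.
suff [tr' [? ? _ ?]] : exists tr', [/\ chain cur tr', chain_end cur tr' = chain_end cur tr,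
    [seq q.2 | q <- tr'] =i [seq q.2 | q <- tr] & perm_eq (chain_path tr') (E ++ chain_path tr)].
  by exists tr'.
elim: E hE => [_|s E IH hE]; first by exists tr.
have [|tr1 [a1 a2 a3 a4]] := IH; first by move=> x xE; apply: hE; rewrite inE xE orbT.
have [w wtr sC] := hE s (mem_head _ _).
have [||tr2 [b1 b2 b3 b4]] := @chain_insert s w cur tr1 a1 => //; first by rewrite a3.
exists tr2; split=> //; first by rewrite b2.
  by move=> x; rewrite b3.
by rewrite (perm_trans b4) //= perm_cons.
Qed.
End Chain.

Lemma linked_cycle C c : isnode h C -> linked h C c C -> uniq c -> 1 < size c -> cycle h c.
Proof.
move=> nC; case: c => [|x c] //= /and3P[xC pc lC] /andP[xc _] sc.
rewrite rcons_path pc /=; apply: (isnode_adj hsym hdia nC lC xC).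
apply: contraNneq xc => <-; case: c sc {pc lC} => //= y c _; exact: mem_last.
Qed.

Let d0 : leg * seq T := ((0, 0, 0), [::]).

Lemma follow_chain N C U F legs cur t vs :
  all (leg_ok N C U) F -> [seq f.1 | f <- F] = legs ->
  all (fun i => i < size legs) t -> follow legs cur t = Some vs ->
  exists tr, [/\ chain N C cur tr, [seq q.2 | q <- tr] = vs &
    perm_eq (chain_path tr) (flatten [seq (nth d0 F i).2 | i <- t])].
Proof.
move=> aF eF; elim: t cur vs => [|i t IH] cur vs /=; first by move=> _ [<-]; exists [::].
case/andP=> ilt alt.
have szF : size F = size legs by rewrite -eF size_map.
have := allP aF (nth d0 F i); rewrite mem_nth ?szF // => /(_ isT).
have -> : nth (0, 0, 0) legs i = (nth d0 F i).1 by rewrite -eF (nth_map d0) ?szF.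
case: (nth d0 F i) => [[[u v] n] p] /= /and4P[uN vN lp _].
rewrite -[eqn u cur]/(u == cur) -[eqn v cur]/(v == cur).
case: (u =P cur) => [<-|_].
  case e: (follow legs v t) => [vs'|] //= [<-].
  have [tr [c1 c2 c3]] := IH _ _ alt e.
  exists ((p, v) :: tr); rewrite /= lp vN c2; split=> //.
  by rewrite /chain_path /= perm_cat2l.
case: (v =P cur) => [<-|_] //.
case e: (follow legs u t) => [vs'|] //= [<-].
have [tr [c1 c2 c3]] := IH _ _ alt e.
exists ((rev p, u) :: tr); rewrite /= (linked_rev hsym) // uN c2; split=> //.
by rewrite /chain_path /= perm_cat // perm_rev.
Qed.

(** The trail uses every leg with specials and thus covers [U]; the specials still missing lie in
    nodes of required labels and are inserted there. *)
Lemma good_covered st : 2 < #|S| -> real st -> good st -> covered.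
Proof.
case: st => [[N legs] req] cS [C [F [U R0]]].
have [F' [[/= pF aF nC uF [US UF SU]] _ eF]] := realizes_perm R0 (perm_refl legs).
move: F' pF aF uF UF eF {R0 F} => F pF aF uF UF eF /=.
case: (filter heavy legs) (mem_filter heavy ^~ legs) => [|[[u v0] n0] hl] //= hmem.
case: find_trail => [t|] //; rewrite /closed_trail.
case/and4P=> ut alt hvy; case efo: (follow _ _ _) => [vs|] // /andP[/eqP lvs reqvs].
have [tr [c1 c2 c3]] := follow_chain aF eF alt efo.
have uN : u < N.
  have /= := hmem (u, v0, n0); rewrite mem_head => /esym/andP[_].
  by rewrite -eF => /mapP[f fF e]; have := allP aF _ fF; rewrite /leg_ok -e => /and4P[].
have szF : size F = size legs by rewrite -eF size_map.
have [t' pt] : exists t', perm_eq (t ++ t') (iota 0 (size legs)).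
  exists [seq i <- iota 0 (size legs) | i \notin t].
  apply: uniq_perm; rewrite ?iota_uniq //.
    rewrite cat_uniq ut filter_uniq ?iota_uniq // andbT /=.
    by apply/hasPn => i; rewrite mem_filter => /andP[].
  move=> i; rewrite mem_cat mem_filter; case: (boolP (i \in t)) => //= it.
  by rewrite mem_iota add0n (allP alt).
have pp : perm_eq (flatten [seq (nth d0 F i).2 | i <- t] ++ flatten [seq (nth d0 F i).2 | i <-
  t']) (paths F).
  rewrite -flatten_cat -map_cat /paths; apply: perm_flatten.
  rewrite (perm_trans (perm_map _ pt)) //.
  have -> : [seq (nth d0 F i).2 | i <- iota 0 (size legs)] = [seq f.2 | f <- mkseq (nth d0 F)
    (size F)].
    by rewrite /mkseq -map_comp szF.
  by rewrite mkseq_nth.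
have utr : uniq (chain_path tr).
  by rewrite (perm_uniq c3); move: uF; rewrite -(perm_uniq pp) cat_uniq => /and3P[].
have Utr s : s \in U -> s \in chain_path tr.
  move=> sU; rewrite (perm_mem c3); have /flattenP[p /mapP[f fF ->] sf] := UF _ sU.
  apply/flattenP; exists f.2 => //; have ilt : index f F < size legs by rewrite -szF index_mem.
  have := allP hvy (index f F); rewrite mem_iota add0n => /(_ ilt).
  rewrite mem_natE -eF (nth_map d0) ?szF // nth_index // /heavy.
  have := allP aF _ fF => /and4P[_ _ _ /eqP<-].
  have -> : count (mem U) f.2 != 0 by rewrite -lt0n -has_count; apply/hasP; exists s.
  by move=> it; apply/mapP; exists (index f F); rewrite ?nth_index.
pose E := [seq s <- enum S | s \notin chain_path tr].
have [|tr' [e1 e2 e3]] := @chain_inserts N C E u tr c1.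
  move=> s; rewrite mem_filter mem_enum => /andP[st sS].
  have [|w wr /andP[_ sw]] := SU _ sS; first by apply: contra st => /Utr.
  by exists w => //; rewrite c2 -mem_natE; apply: (allP reqvs).
have utr' : uniq (chain_path tr').
  rewrite (perm_uniq e3) cat_uniq utr filter_uniq ?enum_uniq // andbT /=.
  apply/hasPn => s /= st; rewrite mem_filter st //.
have Str' : {subset S <= chain_path tr'}.
  move=> s sS; rewrite (perm_mem e3) mem_cat mem_filter mem_enum sS andbT.
  by case: (s \in _).
have sz : 2 < size (chain_path tr').
  apply: leq_trans cS _; rewrite -(card_uniqP utr'); apply/subset_leq_card/subsetP; exact: Str'.
exists (chain_path tr'); split=> //.
apply: (linked_cycle (nC _ uN) _ utr' (ltnW sz)).
have := chain_linked nC e1 utr'; rewrite e2 /chain_end c2 lvs //; exact.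
Qed.
End Realize.

(** * Refining a frame *)

Lemma split_has (X : eqType) (a : pred X) (p : seq X) : has a p -> exists p1 y m p2,
  [/\ p = p1 ++ (y :: m) ++ p2, a y, a (last y m), ~~ has a p1 & ~~ has a p2].
Proof.
elim: p => [|x p IH] //=; have [hp|hp] := boolP (has a p).
  have [p1 [y [m [p2 [-> ay al n1 n2]]]]] := IH hp.
  have [ax|ax] := boolP (a x) => _.
    by exists [::], x, (p1 ++ y :: m), p2; rewrite last_cat -!catA.
  by exists (x :: p1), y, m, p2; rewrite /= negb_or ax.
by rewrite orbF => ax; exists [::], x, [::], p.
Qed.

Lemma picks_map (X Y : eqType) (f : X -> Y) (s : seq X) x : x \in s ->
  exists2 s', perm_eq s (x :: s') & (f x, [seq f z | z <- s']) \in picks [seq f z | z <- s].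
Proof.
elim: s => //= z s IH; rewrite inE => /predU1P[->|/IH[s' ps' hs']].
  by exists s; rewrite ?perm_refl // mem_head.
exists (z :: s'); last by rewrite inE; apply/orP; right; apply/mapP;
  exists (f x, [seq f z | z <- s']).
by apply/permP => a; move/permP: ps' => /(_ a) /= ->; lia.
Qed.

Lemma arms3_mem (f : option bool -> nat) (t : option bool -> option bool) : injective t ->
  (f (t (Some true)), f (t (Some false)),
    f (t None)) \in arms3 (f (Some true)) (f (Some false)) (f None).
Proof.
move=> tI; rewrite mem_undup !inE.
have n1 : t (Some true) != t (Some false) by rewrite (inj_eq tI).
have n2 : t (Some true) != t None by rewrite (inj_eq tI).
have n3 : t (Some false) != t None by rewrite (inj_eq tI).
move: n1 n2 n3; case: (t (Some true)) => [[]|]; case: (t (Some false)) => [[]|];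
  case: (t None) => [[]|] //;
  by rewrite !eqxx ?orbT.
Qed.

Lemma mem_center k l n : n = k + l -> 0 < k -> 0 < l -> forall q, q \in arms3 k l 0 ->
  (q, false) \in centers n.
Proof.
move=> -> k0 l0 q qa; rewrite mem_cat; apply/orP; right; apply/flattenP.
exists [seq (t, false) | t <- arms3 k (k + l - k) 0].
  by apply/mapP; exists k => //; rewrite mem_iota; lia.
by apply/mapP; exists q; rewrite ?addKn.
Qed.

Lemma mem_center_true k l n : n = k + 1 + l -> forall q, q \in arms3 k l 0 ->
  (q, true) \in centers n.
Proof.
move=> -> q qa; rewrite mem_cat; apply/orP; left; apply/flattenP.
exists [seq (t, true) | t <- arms3 k (k + 1 + l - k.+1) 0].
  by apply/mapP; exists k => //; rewrite mem_iota; lia.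
by apply/mapP; exists q => //; rewrite addn1 addKn.
Qed.

Lemma mem_landing k l (d : bool) n : n = k + d + l -> ((k, l), d) \in landings n.
Proof.
move=> ->; rewrite mem_cat; case: d; apply/orP; [right|left].
  by apply/mapP; exists k; rewrite ?mem_iota; [lia|congr (_, _, _); lia].
by apply/mapP; exists k; rewrite ?mem_iota; [lia|congr (_, _, _); lia].
Qed.

Section Expand.
Variables (T : finType) (h : rel T).
Hypotheses (hsym : symmetric h) (hirr : irreflexive h).
Hypotheses (hclaw : clawless h) (hdia : diamondless h).
Variable S : {set T}.

Lemma arm_gate E c q : isnode h E -> path h c q -> last c q \in E ->
  exists D, [/\ isnode h D, c \in D & linked h E (rev q) D].
Proof.
move=> nE; case: q => [|x q] /=; first by exists E; rewrite nE eqxx.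
case/andP=> cx pq lq; exists (node h c x); rewrite isnode_node // node_l; split=> //.
by apply: linked_rev => //=; rewrite node_r pq.
Qed.

Lemma arm_edge c q b : path h c q -> h (last c q) b ->
  exists Dc Db, [/\ isnode h Dc, isnode h Db, c \in Dc, b \in Db & linked h Dc q Db].
Proof.
case: q => [|x q] /=.
  by move=> _ cb; exists (node h c b), (node h c b); rewrite /= eqxx isnode_node // node_l node_r.
case/andP=> cx pq xb; exists (node h c x), (node h (last x q) b).
by rewrite !isnode_node // node_l !node_r pq node_l.
Qed.

Lemma has_count0 (U : {set T}) s : ~~ has (mem U) s -> count (mem U) s = 0.
Proof. by rewrite has_count -leqNgt leqn0 => /eqP. Qed.

(** An unblocked leg has a fan. It is recentred at the start [c] of the third path by adding to the
    other two paths the pieces of the leg that join [c] to their starts. [star] at [c] and at the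
    landing point [b] then supplies the two new nodes. *)
Lemma fan_child C U N req g p Fr :
  realizes h S C ((g, p) :: Fr) U (N, g :: [seq f.1 | f <- Fr], req) -> heavy g ->
  blocked h p [set x in paths Fr] \/
  exists st, st \in children N req g [seq f.1 | f <- Fr] /\ real h S st.
Proof.
move=> [/= _ /andP[gok Frok] nC uF [US UF SU]] gh.
have upF : uniq (p ++ paths Fr) := uF.
have UpF : {subset U <= p ++ paths Fr} := UF.
case: g {uF UF} gok gh => [[u v] n] /and4P[/= uN vN lp /eqP cn] gh.
have hp : has (mem U) p by rewrite has_count cn lt0n.
have [p1 [y [m [p2 [ep ay al np1 np2]]]]] := split_has hp.
have up : uniq p by move: upF; rewrite cat_uniq => /and3P[].
have dis x : x \in p -> x \notin paths Fr.
  move: upF; rewrite cat_uniq => /and3P[_ /hasPn H _] xp; apply/negP => xF.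
  by have := H x xF; rewrite /= xp.
set R := [set x in paths Fr].
have lp' : linked h (C u) (p1 ++ (y :: m) ++ p2) (C v) by rewrite -ep.
have up' : uniq (p1 ++ (y :: m) ++ p2) by rewrite -ep.
have pR : all (fun x => x \notin R) (p1 ++ (y :: m) ++ p2).
  by rewrite -ep; apply/allP => x xp; rewrite inE dis.
case: (fan_or_blocked hsym lp' up' pR) => [bl|]; first by left; rewrite ep.
move=> [s [a [q0 [sI aS q0P q0D]]]]; right.
set c := a None; have cm : c \in y :: m by have := aS None; rewrite inE.
have [m1 [m2 em]] : exists m1 m2, y :: m = m1 ++ c :: m2.
  by case/splitPr: cm => m1 m2; exists m1, m2.
have ay' : a (Some true) = y by have := aS (Some true); rewrite inE => /eqP.
have az' : a (Some false) = last y m by have := aS (Some false); rewrite inE => /eqP.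
have um : uniq (m1 ++ c :: m2) by rewrite -em; move: up'; rewrite !cat_uniq => /and4P[_ _].
have lmid : linked h (C u) ((p1 ++ m1) ++ c :: (m2 ++ p2)) (C v).
  by have := lp'; rewrite em -!catA.
have [q qE] : exists q : option bool -> seq T, forall i,
    q i = match i with Some true => rev m1 | Some false => m2 | None => [::] end ++ q0 i.
  by eexists.
have qP i : path h c (q i) && (last c (q i) \in leg_snk h (C u) (C v) R (s i)).
  have [pp ll _ _] := q0P i; have := linked_mid hsym lmid.
  rewrite rev_cat !cat_path !last_cat => -[/andP[pm1 _] _ /andP[pm2 _] _].
  rewrite qE cat_path last_cat; case: i pp ll => [[]|] //= pp ll.
  - have -> : last c (rev m1) = a (Some true).
      rewrite ay'; case: (m1) em => [|x m1'] /= [-> _] //; by rewrite rev_cons last_rcons.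
    by rewrite pm1 pp.
  - have -> : last c m2 = a (Some false).
      have : last y (y :: m) = last y (m1 ++ c :: m2) by rewrite em.
      by rewrite az' /= last_cat /= => ->.
    by rewrite pm2 pp.
  - by rewrite pp.
(* The fan may permute its targets; [t j] is the path that arrives at the target [j]. *)
pose t j := odflt None [pick i | s i == j].
have sI' : bijective s by apply: injF_bij.
have tP j : s (t j) = j.
  rewrite /t; case: pickP => [i /eqP|] //=; have [s' _ s's] := sI' => /(_ (s' j)).
  by rewrite s's eqxx.
have tI : injective t by apply: can_inj tP.
have qu := qP (t (Some true)); have qv := qP (t (Some false)); have qn := qP (t None).
rewrite !tP /= in qu qv qn.
case/andP: qu => qup qul; case/andP: qv => qvp qvl; case/andP: qn => qnp.
rewrite inE => /existsP[b /andP[bR qnb]].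
have [D1 [nD1 cD1 l1]] := arm_gate (nC _ uN) qup qul.
have [D2 [nD2 cD2 l2]] := arm_gate (nC _ vN) qvp qvl.
have [D3 [E3 [nD3 nE3 cD3 bE3 l3]]] := arm_edge qnp qnb.
have {}l3 := linked_rev hsym l3.
have bF : b \in paths Fr by move: bR; rewrite inE.
have [f fFr bf] : exists2 f, f \in Fr & b \in f.2.
  by case/flattenP: bF => _ /mapP[f fFr ->] bf; exists f.
have [Fr' pFr hpick] := picks_map (fun f : leg * seq T => f.1) fFr.
case: f fFr bf pFr hpick => [[[a' b'] m'] p'] fFr /= bp' pFr hpick.
have := allP Frok _ fFr => /and4P[/= aN bN lp'' /eqP cm'].
have [h1 [h2 ep']] : exists h1 h2, p' = h1 ++ b :: h2.
  by case/splitPr: bp' => h1 h2; exists h1, h2.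
have [[X1 [nX1 bX1 k1]] [X2 [nX2 bX2 k2]]] : (exists X, [/\ isnode h X,
  b \in X & linked h (C a') h1 X]) /\
    (exists Y, [/\ isnode h Y, b \in Y & linked h Y h2 (C b')]).
  by apply: linked_arms; rewrite -?ep' ?nC.
have {}k2 := linked_rev hsym k2.
have pPF : perm_eq (paths Fr) (p' ++ paths Fr') by apply: (perm_paths pFr).
have q0free i x : x \in q0 i -> (x \notin paths Fr) && (x \notin y :: m).
  by case: (q0P i) => _ _ /(_ x) + _ xq => /(_ xq); rewrite !inE.
pose Q := q0 (Some true) ++ q0 (Some false) ++ q0 None.
have Qfree x : x \in Q -> (x \notin paths Fr) && (x \notin y :: m).
  by rewrite !mem_cat => /or3P[] /q0free.
have uQ : uniq Q.
  have uq0 i : uniq (q0 i) by case: (q0P i).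
  rewrite /Q !cat_uniq !uq0 /= andbT; apply/andP; split; apply/hasPn => x.
    by rewrite mem_cat => /orP[] xq; apply/negP => /= xq'; have := q0D _ _ _ xq xq'.
  by move=> xq; apply/negP => /= xq'; have := q0D _ _ _ xq xq'.
have uall : uniq ((m1 ++ c :: m2) ++ Q ++ (h1 ++ b :: h2) ++ paths Fr').
  have uF : uniq (p' ++ paths Fr').
    by rewrite -(perm_uniq pPF); move: upF; rewrite cat_uniq => /and3P[].
  rewrite -ep' cat_uniq um (cat_uniq Q) uQ uF -em andbT /=; apply/andP; split; apply/hasPn => x.
    rewrite mem_cat -(perm_mem pPF) => /orP[/Qfree/andP[] //|xF]; apply/negP => /= xm.
    by have := dis x; rewrite ep !mem_cat xm orbT xF => /(_ isT).
  by rewrite -(perm_mem pPF) => xF; apply/negP => /= /Qfree/andP[]; rewrite xF.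
pose qu := q (t (Some true)); pose qv := q (t (Some false)); pose qn := q (t None).
have pq : perm_eq (qu ++ qv ++ qn) (m1 ++ m2 ++ Q).
  apply/permP => z; rewrite /qu /qv /qn /Q !count_cat.
  have cq i : count z (q i) = (match i with Some true => count z m1 | Some false =>
    count z m2 | None => 0 end) + count z (q0 i).
    by rewrite qE count_cat; case: i => [[]|] //; rewrite count_rev.
  rewrite !cq; have n1 : t (Some true) != t (Some false) by rewrite (inj_eq tI).
  have n2 : t (Some true) != t None by rewrite (inj_eq tI).
  have n3 : t (Some false) != t None by rewrite (inj_eq tI).
  move: n1 n2 n3; clear; case: (t (Some true)) => [[]|]; case: (t (Some false)) => [[]|];
    case: (t None) => [[]|] //= _ _ _; lia.
have uc : uniq (c :: rev qu ++ rev qv ++ rev qn).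
  have /permP pq' := pq;
    suff /perm_uniq -> : perm_eq (c :: rev qu ++ rev qv ++ rev qn) (c :: m1 ++ m2 ++ Q).
    have : perm_eq ((c :: m1 ++ m2 ++ Q) ++ ((h1 ++ b :: h2) ++ paths Fr')) ((m1 ++ c :: m2) ++ Q
      ++ (h1 ++ b :: h2) ++ paths Fr').
      by apply/permP => z; rewrite /= !count_cat /=; clear; lia.
    by move/perm_uniq; rewrite uall cat_uniq => /and3P[].
  by apply/permP => z; have := pq' z; rewrite /= !count_cat !count_rev => ->.
have [D [b1 [b2 [b3 [nD cD eb [s1 s2 s3]]]]]] := star hsym hirr hclaw hdia nD1 nD2 nD3 cD1 cD2
  cD3 l1 l2 l3 uc.
have {}s3 := linked_rev hsym s3.
have ub : uniq (b :: h1 ++ rev h2 ++ rev (rev qn ++ nseq b3 c)).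
  have /permP pq' := pq.
  have b301 : b3 = 0 \/ b3 = 1 by move: (b3) eb; clear => b3 eb; lia.
  pose rest := qu ++ qv ++ nseq (1 - b3) c ++ paths Fr'.
  have : perm_eq ((b :: h1 ++ rev h2 ++ rev (rev qn ++ nseq b3 c)) ++ rest) ((m1 ++ c :: m2) ++ Q
    ++ (h1 ++ b :: h2) ++ paths Fr').
    apply/permP => z; have := pq' z; rewrite /rest /= !(count_cat, count_rev, count_nseq) /= => e.
    by move: e; case: b301 => ->; case: (z c); clear => e; lia.
  by move/perm_uniq; rewrite uall cat_uniq => /and3P[].
have [D' [e1 [e2 [e3 [nD' bD' ee [r1 r2 r3]]]]]] := star hsym hirr hclaw hdia nX1 nX2 nE3 bX1 bX2
  bE3 k1 k2 s3 ub.
(* [star] does not control which arms receive [c] and [b]; if special, they are required at the new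
   nodes instead of being counted on a leg. *)
pose U' := U :\ c :\ b.
pose C' w := if w == N then D else if w == N.+1 then D' else C w.
have C'N w : w < N -> C' w = C w.
  by move=> wN; rewrite /C' !ltn_eqF // ltnW.
have cp : c \in p by rewrite ep !mem_cat cm orbT.
have cF : c \notin paths Fr by apply: dis.
have bp : b \notin p by apply/negP => /dis; rewrite bF.
have bFr' : b \notin paths Fr'.
  move: uall; rewrite !cat_uniq => /and3P[_ _ /and3P[_ _ /and3P[_ /hasPn H _]]].
  by apply/negP => /H; rewrite /= mem_cat mem_head orbT.
have U'E l : c \notin l -> b \notin l -> count (mem U') l = count (mem U) l.
  move=> cl bl; apply: eq_in_count => x xl; rewrite /= !inE.
  by rewrite (memPn cl _ xl) (memPn bl _ xl).
have mp x : x \in m1 ++ c :: m2 -> x \in p by rewrite -em ep !mem_cat => ->; rewrite orbT.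
have Um x : x \in U -> x \in p -> x \in m1 ++ c :: m2.
  move=> xU; rewrite -em ep !mem_cat => /or3P[] // xp; [case/hasP: np1|case/hasP: np2]; by exists x.
have nbm : b \notin m1 ++ c :: m2 by apply: contra bp => /mp.
have [ncm1 ncm2] : c \notin m1 /\ c \notin m2.
  move: um; rewrite cat_uniq /= => /and3P[_ /norP[cm1 _] /andP[cm2 _]]; by split.
have [nbm1 nbm2] : b \notin m1 /\ b \notin m2.
  by move: nbm; rewrite mem_cat inE => /norP[-> /norP[_ ->]].
pose cnt i := match i with Some true => count (mem U) m1 | Some false =>
  count (mem U) m2 | None => 0 end.
(* The paths [q0] carry no special of [U]: they avoid the other legs and the part of this leg from
   its first to its last special. *)
have cq i : count (mem U') (q i) = cnt i.
  have -> : count (mem U') (q i) = cnt i + count (mem U') (q0 i).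
    by rewrite qE count_cat; case: i => [[]|] //=; rewrite ?count_rev U'E.
  rewrite [X in _ + X](_ : _ = 0) ?addn0 //; apply: has_count0;
    apply/hasPn => x /q0free/andP[xF xm].
  apply/negP; rewrite /= !inE => /and3P[_ _ xU]; have := UpF _ xU.
  by rewrite mem_cat (negPf xF) orbF => /(Um _ xU); rewrite -em (negPf xm).
have cc k : count (mem U') (nseq k c) = 0 by rewrite count_nseq /= !inE eqxx andbF.
have cb k : count (mem U') (nseq k b) = 0 by rewrite count_nseq /= !inE eqxx.
have [nch nbh] : c \notin p' /\ (b \notin h1) /\ (b \notin h2).
  split; first by apply: contra cF; rewrite (perm_mem pPF) mem_cat => ->.
  by move: uall; rewrite !cat_uniq =>
    /and3P[_ _ /and3P[_ _ /and3P[/and3P[_ /norP[-> _] /andP[-> _]] _ _]]].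
have [nch1 nch2] : c \notin h1 /\ c \notin h2.
  by move: nch; rewrite ep' mem_cat inE => /norP[-> /norP[_ ->]].
case: nbh => nbh1 nbh2.
pose Fn := [:: ((u, N, cnt (t (Some true))), rev qu ++ nseq b1 c), ((v, N, cnt (t (Some false))),
  rev qv ++ nseq b2 c),
   ((N, N.+1, cnt (t None)), rev (rev qn ++ nseq b3 c) ++ nseq e3 b),
   ((a', N.+1, count (mem U) h1), h1 ++ nseq e1 b), ((b', N.+1, count (mem U) h2),
     rev h2 ++ nseq e2 b) & Fr'] : frame T.
have pFn : perm_eq (paths Fn) ((m1 ++ c :: m2) ++ Q ++ (h1 ++ b :: h2) ++ paths Fr').
  have /permP pq' := pq; apply/permP => z; have := pq' z.
  rewrite /paths /= !(count_cat, count_rev, count_nseq) /= -/(paths Fr').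
  have zc : z c * (b1 + b2 + b3) = z c by rewrite eb muln1.
  have zb : z b * (e1 + e2 + e3) = z b by rewrite ee muln1.
  by rewrite !mulnDr in zc zb *; move: zc zb; clear; lia.
exists (N.+2, [:: (u, N, cnt (t (Some true))), (v, N, cnt (t (Some false))), (N, N.+1,
  cnt (t None)),
    (a', N.+1, count (mem U) h1), (b', N.+1, count (mem U) h2) & [seq f.1 | f <- Fr']],
  nseq (c \in U) N ++ nseq (b \in U) N.+1 ++ req); split.
  apply/flattenP.
  exists (flatten [seq let: ((a, b', m), rest') := q in
       [seq let: ((m1, m2), d) := l in
          (N.+2,
           [:: (u, N, cnt (t (Some true))), (v, N, cnt (t (Some false))), (N, N.+1,
             cnt (t None)), (a, N.+1, m1), (b', N.+1, m2) & rest'],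
           nseq (nat_of_bool (c \in U)) N ++ nseq (nat_of_bool d) N.+1 ++ req)
       | l <- landings m]
     | q <- picks [seq f.1 | f <- Fr]]).
    apply/mapP; exists ((cnt (t (Some true)), cnt (t (Some false)), cnt (t None)), c \in U) => //.
    have na := arms3_mem cnt tI.
    have nE : n = count (mem U) m1 + (c \in U) + count (mem U) m2.
      rewrite -cn ep em !count_cat /= (has_count0 np1) (has_count0 np2); clear; lia.
    case: (boolP (c \in U)) nE => cU nE; first exact: mem_center_true nE _ na.
    (* If the centre is not special, the first and the last special lie on different sides of it. *)
    apply: mem_center na; rewrite ?nE ?addn0 //; rewrite -has_count; apply/hasP.
      exists y => //; case: (m1) em => [|x m1'] /= [] => [e|->]; last by rewrite mem_head.
      by move: cU; rewrite -e; case/negP.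
    exists (last y m) => //; have : last y (y :: m) = last y (m1 ++ c :: m2) by rewrite em.
    rewrite last_cat /=; case: (m2) => [|x m2'] /= e; last by rewrite e mem_last.
    by case/negP: cU; rewrite -e.
  apply/flattenP; exists [seq let: ((m1, m2), d) := l in
          (N.+2,
           [:: (u, N, cnt (t (Some true))), (v, N, cnt (t (Some false))), (N, N.+1,
             cnt (t None)), (a', N.+1, m1), (b', N.+1, m2) & [seq f.1 | f <- Fr']],
           nseq (nat_of_bool (c \in U)) N ++ nseq (nat_of_bool d) N.+1 ++ req)
       | l <- landings m'].
    by apply/mapP; exists (((a', b', m'), [seq f.1 | f <- Fr'])).
  apply/mapP; exists ((count (mem U) h1, count (mem U) h2), b \in U) => //.
  by apply: mem_landing; rewrite -cm' ep' count_cat /=; clear; lia.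
exists C', Fn, U'.
have C'0 : C' N = D by rewrite /C' eqxx.
have C'1 : C' N.+1 = D' by rewrite /C' eqxx (gtn_eqF (ltnSn N)).
split=> /=.
- exact: perm_refl.
- rewrite /leg_ok /= !(count_cat, count_rev) !cc !cb !addn0 !cq.
  rewrite !C'0 !C'1 (C'N _ uN) (C'N _ vN) (C'N _ aN) (C'N _ bN) s1 s2 r3 r1 r2 !U'E // !eqxx
    !andbT /=.
  rewrite !(ltn_trans uN, ltn_trans vN, ltn_trans aN, ltn_trans bN, ltnSn, ltnW) //=.
  apply/allP => f fF; have fFr1 : f \in Fr by rewrite (perm_mem pFr) inE fF orbT.
  have := allP Frok _ fFr1 => /and4P[f1 f2 f3 f4]; rewrite /leg_ok !C'N // f3.
  rewrite (ltn_trans f1) ?(ltn_trans f2) /= ?ltnS ?leqnSn //.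
  rewrite U'E //; first by apply: contra cF => cf; apply/flattenP; exists f.2; rewrite ?map_f.
  by apply: contra bFr' => cf; apply/flattenP; exists f.2; rewrite ?map_f.
- move=> w; rewrite ltnS leq_eqVlt => /predU1P[->|]; first by rewrite C'1.
  by rewrite ltnS leq_eqVlt => /predU1P[->|wN]; rewrite ?C'0 ?C'N ?nC.
- by rewrite (perm_uniq pFn).
split.
- by apply: subset_trans US; apply: subset_trans (subD1set _ _) (subD1set _ _).
- move=> x; rewrite !inE => /and3P[_ _ xU]; rewrite (perm_mem pFn).
  have := UpF _ xU; rewrite mem_cat => /orP[/(Um _ xU)|]; first by move=> xm; rewrite mem_cat xm.
  by rewrite (perm_mem pPF) ep' => xF; rewrite mem_cat (mem_cat _ Q) xF !orbT.
move=> s0 s0S s0U'; have [s0U|s0U] := boolP (s0 \in U); last first.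
  have [w wr /andP[wN sw]] := SU _ s0S s0U; exists w; first by rewrite !mem_cat wr !orbT.
  by rewrite C'N // sw andbT (ltn_trans wN) // ltnS leqnSn.
move: s0U'; rewrite !inE s0U andbT negb_and !negbK => /orP[]/eqP e0; subst s0.
  exists N.+1; first by rewrite s0U !mem_cat !mem_nseq eqxx !orbT.
  by rewrite C'1 bD' ltnSn.
exists N; first by rewrite s0U !mem_cat !mem_nseq eqxx.
by rewrite C'0 cD andbT ltnS leqnSn.
Qed.
End Expand.

(** * Soundness of the search *)

(* The graph h together with one more vertex, whose neighbourhood is zn, is 3-connected,
   and zn contains no independent triple. *)
Record apex_connected (T : finType) (h : rel T) (zn : {set T}) : Prop := ApexConnected {
  apex_cut1 : forall X Y : {set T}, X != set0 -> #|Y| <= 1 ->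
    (forall a b, a \in X -> h a b -> b \in X :|: Y) -> X :|: Y = setT;
  apex_cut2 : forall X Y : {set T}, X != set0 -> #|Y| <= 2 ->
    (forall a b, a \in X -> h a b -> b \in X :|: Y) -> X :|: Y != setT ->
    exists2 a, a \in X & a \in zn;
  apex_claw : forall a b c, a \in zn -> b \in zn -> c \in zn -> uniq [:: a; b; c] ->
    [|| h a b, h a c | h b c]
}.

Section Search.
Variables (T : finType) (h : rel T) (zn : {set T}).
Hypotheses (hsym : symmetric h) (hirr : irreflexive h).
Hypotheses (hclaw : clawless h) (hdia : diamondless h) (hapex : apex_connected h zn).
Variable S : {set T}.

(* The intersection of X1 and X2 has no neighbour outside, so it is empty by connectedness. *)
Lemma blocked_apart (p1 p2 : seq T) (R1 R2 X1 X2 Y1 Y2 : {set T}) :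
  {subset p1 <= R2} -> {subset p2 <= R1} -> (forall x, x \in p1 -> x \notin p2) -> p2 != [::] ->
  [disjoint X1 & R1] -> [disjoint X2 & R2] -> Y1 \subset p1 -> Y2 \subset p2 ->
  (forall a b, a \in X1 -> h a b -> b \in X1 :|: Y1) ->
  (forall a b, a \in X2 -> h a b -> b \in X2 :|: Y2) ->
  [disjoint X1 & X2] /\ forall a b, a \in X1 -> b \in X2 -> ~~ h a b.
Proof.
move=> pR2 pR1 p12 p2n d1 d2 s1 s2 c1 c2.
have Y1X2 x : x \in Y1 -> x \notin X2.
  move=> /(subsetP s1)/pR2 xR; apply: contraL xR => xX.
  by move: d2; rewrite disjoint_subset => /subsetP/(_ _ xX).
have Y1Y2 x : x \in Y1 -> x \notin Y2.
  by move=> /(subsetP s1)/p12; apply: contra => /(subsetP s2).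
have Y2X1 x : x \in Y2 -> x \notin X1.
  move=> /(subsetP s2)/pR1 xR; apply: contraL xR => xX.
  by move: d1; rewrite disjoint_subset => /subsetP/(_ _ xX).
have I0 : X1 :&: X2 = set0.
  apply/eqP; apply: contraT => In0; case: p2 p2n pR1 {p12 s2} => // y p2 _ pR1.
  have cl a b : a \in X1 :&: X2 -> h a b -> b \in X1 :&: X2 :|: set0.
    rewrite !inE orbF => /andP[a1 a2] ab.
    have := c1 _ _ a1 ab; have := c2 _ _ a2 ab; rewrite !inE => /orP[b2|b2] /orP[b1|b1].
    - by rewrite b1.
    - by have := Y1X2 _ b1; rewrite b2.
    - by have := Y2X1 _ b2; rewrite b1.
    - by have := Y1Y2 _ b1; rewrite b2.
  have := apex_cut1 hapex In0 _ cl; rewrite cards0 => /(_ isT)/setP/(_ y).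
  rewrite !inE orbF => /andP[yX _].
  by move: d1; rewrite disjoint_subset => /subsetP/(_ _ yX); rewrite inE pR1 // mem_head.
split; first by rewrite -setI_eq0 I0.
move=> a b aX bX; apply/negP => ab.
have := c1 _ _ aX ab; rewrite inE => /orP[bX1|/Y1X2]; last by rewrite bX.
by have : b \in X1 :&: X2 by [rewrite inE bX1|]; rewrite I0 inE.
Qed.

(** A vertex of [R] lies outside [X :|: Y], so [Y] is a genuine cut and [apex_cut2] applies. *)
Lemma blocked_apex (p : seq T) (R : {set T}) : {in p, forall x, x \notin R} -> R != set0 ->
  blocked h p R ->
  exists a (X Y : {set T}), [/\ a \in X, a \in zn, [disjoint X & R], Y \subset p &
    forall a b, a \in X -> h a b -> b \in X :|: Y].
Proof.
move=> pR /set0Pn[y yR] [X [Y [X0 d s c2 cl]]].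
have [|a aX az] := apex_cut2 hapex X0 c2 cl; last by exists a, X, Y.
apply/eqP => /setP/(_ y); rewrite !inE => /orP[yX|yY].
  by move: d; rewrite disjoint_subset => /subsetP/(_ _ yX); rewrite inE yR.
by have := pR _ (subsetP s _ yY); rewrite yR.
Qed.

(** Behind each cut there is a neighbour of the apex; by [blocked_apart] the three are distinct and
    pairwise nonadjacent, against [apex_claw]. *)
Lemma not_three_blocked (p1 p2 p3 : seq T) (R1 R2 R3 : {set T}) :
  uniq (p1 ++ p2 ++ p3) -> p1 != [::] -> p2 != [::] -> p3 != [::] ->
  {in p1, forall x, x \notin R1} -> {in p2, forall x, x \notin R2} ->
    {in p3, forall x, x \notin R3} ->
  {subset p2 ++ p3 <= R1} -> {subset p1 ++ p3 <= R2} -> {subset p1 ++ p2 <= R3} ->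
  blocked h p1 R1 -> blocked h p2 R2 -> blocked h p3 R3 -> False.
Proof.
rewrite !cat_uniq => /and3P[_ /hasPn h1 /and3P[_ /hasPn h2 _]] n1 n2 n3 q1 q2 q3 s1 s2 s3.
have nz (p : seq T) (R : {set T}) : p != [::] -> {subset p <= R} -> R != set0.
  by case: p => // y p _ sp; apply/set0Pn; exists y; apply: sp; rewrite mem_head.
have [[t21 t31] [t12 t32] [t13 t23]] : [/\ {subset p2 <= R1} /\ {subset p3 <= R1},
    {subset p1 <= R2} /\ {subset p3 <= R2} & {subset p1 <= R3} /\ {subset p2 <= R3}].
  split; split=> x xp; [apply: s1|apply: s1|apply: s2|apply: s2|apply: s3|apply: s3];
    by rewrite mem_cat xp ?orbT.
move=> /(blocked_apex q1 (nz _ _ n2 t21))[a [X1 [Y1 [aX az d1 y1 c1]]]].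
move=> /(blocked_apex q2 (nz _ _ n1 t12))[b [X2 [Y2 [bX bz d2 y2 c2]]]].
move=> /(blocked_apex q3 (nz _ _ n1 t13))[c [X3 [Y3 [cX cz d3 y3 c3]]]].
have e12 x : x \in p1 -> x \notin p2.
  by move=> x1; apply/negP => x2; have := h1 x; rewrite mem_cat x2 /= x1 => /(_ isT).
have e13 x : x \in p1 -> x \notin p3.
  by move=> x1; apply/negP => x2; have := h1 x; rewrite mem_cat x2 orbT /= x1 => /(_ isT).
have e23 x : x \in p2 -> x \notin p3.
  by move=> x1; apply/negP => x2; have := h2 x; rewrite x2 /= x1 => /(_ isT).
have [i12 a12] := blocked_apart t12 t21 e12 n2 d1 d2 y1 y2 c1 c2.
have [i13 a13] := blocked_apart t13 t31 e13 n3 d1 d3 y1 y3 c1 c3.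
have [i23 a23] := blocked_apart t23 t32 e23 n3 d2 d3 y2 y3 c2 c3.
have ne (X Y : {set T}) x y : [disjoint X & Y] -> x \in X -> y \in Y -> x != y.
  move=> d xX yY; apply: contraTneq yY => <-.
  by move: d; rewrite disjoint_subset => /subsetP/(_ _ xX).
have := apex_claw hapex az bz cz; rewrite /= !inE negb_or.
rewrite (ne _ _ _ _ i12 aX bX) (ne _ _ _ _ i13 aX cX) (ne _ _ _ _ i23 bX cX) => /(_ isT).
by rewrite (negPf (a12 _ _ aX bX)) (negPf (a13 _ _ aX cX)) (negPf (a23 _ _ bX cX)).
Qed.

Lemma realizes_frame C F F' U N legs req : realizes h S C F U (N, legs, req) -> perm_eq F F' ->
  realizes h S C F' U (N, [seq f.1 | f <- F'], req).
Proof.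
move=> [/= _ aF nC uF [US UF SU]] pF; split=> //=.
- by rewrite -(perm_all _ pF).
- by rewrite -(perm_uniq (perm_paths pF)).
- by split=> // x /UF; rewrite (perm_mem (perm_paths pF)).
Qed.

Lemma expand_real st : real h S st -> exists2 st', st' \in expand st & real h S st'.
Proof.
case: st => [[N legs] req] [C [F [U rF]]].
rewrite /expand; case e: (filter heavy legs) => [|g1 [|g2 [|g3 s]]];
  try by exists (N, legs, req); [rewrite mem_head|exists C, F, U].
set r := s ++ _.
have pl : perm_eq legs (g1 :: g2 :: g3 :: r).
  by rewrite /r -!cat_cons -e perm_sym perm_filterC.
have [F' [rF' _ eF']] := realizes_perm rF pl.
move: F' rF' eF' => [|[g1' p1] [|[g2' p2] [|[g3' p3] Fr]]] //= rF' [e1 e2 e3 er]; subst g1' g2' g3'.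
have hv g : g \in [:: g1, g2, g3 & s] -> heavy g by rewrite -e mem_filter => /andP[].
have [h1 h2 h3] : [/\ heavy g1, heavy g2 & heavy g3] by split; apply: hv; rewrite !inE eqxx ?orbT.
have fan g p Fr' : realizes h S C ((g, p) :: Fr') U (N, g :: [seq f.1 | f <- Fr'], req) ->
  heavy g ->
    blocked h p [set x in paths Fr'] \/
    exists2 st, st \in children N req g [seq f.1 | f <- Fr'] & real h S st.
  move=> rg gh; have [|[st [? ?]]] := fan_child hsym hirr hclaw hdia rg gh; first by left.
  by right; exists st.
have R1 := realizes_frame rF' (perm_refl _).
have q2 : perm_eq [:: (g1, p1), (g2, p2), (g3, p3) & Fr] [:: (g2, p2), (g1, p1), (g3, p3) & Fr].
  by apply/permP => a /=; rewrite addnCA.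
have q3 : perm_eq [:: (g1, p1), (g2, p2), (g3, p3) & Fr] [:: (g3, p3), (g1, p1), (g2, p2) & Fr].
  by apply/permP => a /=; clear; lia.
have R2 := realizes_frame rF' q2; have R3 := realizes_frame rF' q3.
have lift g rest st : st \in children N req g rest ->
  [|| (g, rest) == (g1, g2 :: g3 :: r), (g, rest) == (g2, g1 :: g3 :: r) | (g, rest) == (g3,
    g1 :: g2 :: r)] ->
  st \in children N req g1 (g2 :: g3 :: r) ++ children N req g2 (g1 :: g3 :: r) ++ children N req
    g3 (g1 :: g2 :: r).
  by move=> hs /or3P[] /eqP[eg el]; subst; rewrite !mem_cat hs ?orbT.
case: (fan _ _ _ R1 h1) => [B1|[st' /lift st1 st2]]; last by exists st'; rewrite // st1 //= er eqxx.
case: (fan _ _ _ R2 h2) => [B2|[st' /lift st1 st2]]; last by exists st';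
  rewrite // st1 //= er eqxx ?orbT.
case: (fan _ _ _ R3 h3) => [B3|[st' /lift st1 st2]]; last by exists st';
  rewrite // st1 //= er eqxx ?orbT.
exfalso; case: rF' => [/= _ /and4P[o1 o2 o3 _] _ uF _].
have uF' : uniq (p1 ++ p2 ++ p3 ++ paths Fr) by [].
have pn g p : leg_ok h N C U (g, p) -> heavy g -> p != [::].
  by case: p => // /and4P[_ _ _ /eqP/= e0]; rewrite /heavy -e0.
move: B1 B2 B3; apply: not_three_blocked; try by [apply: pn o1 h1|apply: pn o2 h2|apply: pn o3 h3].
- by move: uF'; rewrite !catA cat_uniq => /and3P[].
- move=> x x1; rewrite inE; move: uF'; rewrite cat_uniq => /and3P[_ /hasPn H _].
  by apply/negP => xF; have := H x xF; rewrite /= x1.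
- move=> x x1; rewrite inE.
  have: uniq (p2 ++ (p1 ++ p3 ++ paths Fr)) by rewrite uniq_catCA.
  rewrite cat_uniq => /and3P[_ /hasPn H _].
  by apply/negP => xF; have := H x xF; rewrite /= x1.
- move=> x x1; rewrite inE.
  have: uniq (p3 ++ ((p1 ++ p2) ++ paths Fr)) by rewrite uniq_catCA -catA.
  rewrite cat_uniq => /and3P[_ /hasPn H _].
  by apply/negP => xF; have := H x; rewrite -catA => /(_ xF); rewrite /= x1.
- by move=> x; rewrite inE /paths /= !mem_cat => /orP[] ->; rewrite ?orbT.
- by move=> x; rewrite inE /paths /= !mem_cat => /orP[] ->; rewrite ?orbT.
- by move=> x; rewrite inE /paths /= !mem_cat => /orP[] ->; rewrite ?orbT.
Qed.
End Search.

Section SearchSound.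
Variables (T : finType) (h : rel T) (zn : {set T}).
Hypotheses (hsym : symmetric h) (hirr : irreflexive h).
Hypotheses (hclaw : clawless h) (hdia : diamondless h) (hapex : apex_connected h zn).
Variable S : {set T}.

(** Only the bijectivity of [col] matters; a leg whose ends are exchanged has its path reversed. *)
Lemma norm_real st : real h S st -> real h S (norm st).
Proof.
case: st => [[N legs] req] R0; rewrite /norm; set col := discretize _ _ _ _.
case: ifP => // pcol; case: R0 => [C [F [U [/= pF aF nC uF [US UF SU]]]]].
have ucol : uniq col by rewrite (perm_uniq pcol) iota_uniq.
have szcol : size col = N by rewrite (perm_size pcol) size_iota.
have colN w : w < N -> nth 0 col w < N.
  move=> wN; have: nth 0 col w \in col by rewrite mem_nth ?szcol.
  by rewrite (perm_mem pcol) mem_iota.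
have colK w : w < N -> index (nth 0 col w) col = w by move=> wN; rewrite index_uniq ?szcol.
pose flip (f : leg * seq T) := let: ((u, v, n), p) := f in
  if nth 0 col u <= nth 0 col v then (rename col f.1, p) else (rename col f.1, rev p).
have flip1 f : (flip f).1 = rename col f.1 by rewrite /flip; case: f => [[[u v] n] p]; case: ifP.
exists (fun w => C (index w col)), (map flip F), U; split => /=.
- rewrite perm_sym perm_sort perm_sym -map_comp (eq_map (g := rename col \o (fun f : leg * seq T
  => f.1))) //.
  by rewrite map_comp perm_map.
- rewrite all_map; apply/allP => -[[[u v] n] p] /(allP aF)/and4P[/= uN vN lp cn].
  rewrite /leg_ok; case: ifP => le; rewrite /= le /= !colN // !colK // ?count_rev cn ?lp //.
  by rewrite (linked_rev hsym lp).
- move=> w wN; apply: nC; rewrite -szcol index_mem (perm_mem pcol) mem_iota //.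
- have : perm_eq (paths F) (paths (map flip F)).
    apply/permP => a; rewrite /paths !count_flatten -!map_comp; congr sumn; apply: eq_map.
    by case=> [[[u v] n] p] /=; case: ifP; rewrite /= ?count_rev.
  by move/perm_uniq => <-.
split=> //.
  move=> x /UF /flattenP[_ /mapP[f fF ->] xf]; apply/flattenP; exists (flip f).2.
    by rewrite -map_comp; apply/mapP; exists f.
  by move: xf; case: f {fF} => [[[u v] n] p] /=; case: ifP; rewrite //= mem_rev.
move=> s sS sU; have [w wr /andP[wN sw]] := SU s sS sU.
by exists (nth 0 col w); rewrite ?mem_sort ?map_f ?colN ?colK.
Qed.

Lemma mem_dedup L : dedup L =i L.
Proof.
elim: L => //= x L IH y; rewrite inE -IH; case: ifP => //.
by move=> xL; case: eqP => // ->; rewrite xL.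
Qed.

(** A real state always has a real successor, while the search ends with an empty list, so some real
    successor is accepted by [good]. *)
Lemma search_covered k L st : 2 < #|S| -> search k L -> st \in L -> real h S st -> covered h S.
Proof.
move=> cS; elim: k L st => [|k IH] L st; first by case: L.
move=> H stL /(expand_real hsym hirr hclaw hdia hapex)[st' st1 st2].
have {}H : search k (dedup [seq norm st | st <- flatten (map expand L) &
  ~~ good st]) by case: (L) H stL.
have [g|ng] := boolP (good st'); first exact: good_covered cS st2 g.
apply: IH H _ (norm_real st2); rewrite mem_dedup; apply: map_f; rewrite mem_filter ng /=.
by apply/flattenP; exists (expand st) => //; apply: map_f.
Qed.
End SearchSound.

(** * Covering few vertices by a cycle *)

(** An edge [x y] with two nonadjacent common neighbours makes the completion at [x] strictly
    larger, so the process stops; [completion_cycle] carries cycles back at each stage. *)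
Lemma diamondless_closure (T : finType) (h : rel T) :
  symmetric h -> irreflexive h -> clawless h ->
  exists h' : rel T, [/\ symmetric h', irreflexive h', clawless h', diamondless h' &
    subrel h h' /\ forall s, uniq s -> 2 < size s -> cycle h' s ->
      exists s', [/\ uniq s', 2 < size s', cycle h s' & {subset s <= s'}]].
Proof.
have [n] := ubnP #|[pred q : T * T | ~~ h q.1 q.2]|.
elim: n => // n IH in h *; rewrite ltnS => le hsym hirr hclaw.
have [hd|] := boolP [forall q : T * T * (T * T), [&& h q.1.1 q.1.2, h q.1.1 q.2.1, h q.1.2 q.2.1,
    h q.1.1 q.2.2, h q.1.2 q.2.2 & q.2.1 != q.2.2] ==> h q.2.1 q.2.2].
  exists h; split=> //.
    move=> x y a b xy xa ya xb yb ab; move/forallP/(_ ((x, y), (a, b)))/implyP: hd; apply.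
    by rewrite /= xy xa ya xb yb.
  split; first by [].
  by move=> s us ss cs; exists s; split=> // y.
rewrite negb_forall => /existsP[[[x y] [a b]]] /=; rewrite negb_imply.
case/andP=> /and5P[xy xa ya xb /andP[yb ab]] nab.
have sub : subrel h (completion h x) by move=> u v uv; rewrite /completion uv.
have [|h' [s1 s2 s3 s4 [s5 s6]]] := IH (completion h x) _ (completion_sym x hsym)
   (completion_irr x hirr) (completion_clawless hsym hclaw).
  apply: leq_trans le; apply: proper_card; apply/properP; split.
    by apply/subsetP => q; rewrite !inE; apply/contra/sub.
  by exists (a, b); rewrite !inE //= /completion ab xa xb orbT.
exists h'; split=> //; split; first by move=> u v /sub/s5.
move=> s us ss cs; have [s' [us' ss' cs' ss2]] := s6 s us ss cs.
have [s'' [? ? ? sub']] := completion_cycle hsym hirr hclaw xy xa xb ya yb ab nab us' ss' cs'.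
by exists s''; split=> // w /ss2/sub'.
Qed.

Lemma apex_mono (T : finType) (h h' : rel T) (zn : {set T}) : subrel h h' ->
  apex_connected h zn -> apex_connected h' zn.
Proof.
move=> sub [c1 c2 c3]; split.
- by move=> X Y X0 Y1 cl; apply: c1 => // a b aX /sub; apply: cl.
- by move=> X Y X0 Y2 cl; apply: c2 => // a b aX /sub; apply: cl.
- move=> a b c az bz cz u; have := c3 a b c az bz cz u.
  by case/or3P => /sub ->; rewrite ?orbT.
Qed.

Lemma trim_path (T : finType) (r : rel T) (B : {set T}) x s : path r x s -> last x s \in B ->
  uniq (x :: s) ->
  exists s', [/\ path r x s', last x s' \in B, uniq (x :: s'), {subset x :: s' <= x :: s} &
    {in belast x s', forall y, y \notin B}].
Proof.
elim: s x => [|y s IH] x /= ps lB us; first by exists [::]; split.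
have [xB|xB] := boolP (x \in B).
  by exists [::]; split=> // z; rewrite inE => /eqP->; apply: mem_head.
case/andP: ps => xy ps; move: us => /andP[nx us].
have [s' [p' l' u' sub' nB]] := IH y ps lB us.
exists (y :: s'); split=> //=; rewrite ?xy //.
- by apply/andP; split; [apply: contra nx; apply: sub'|exact: u'].
- by move=> z; rewrite inE => /predU1P[->|/sub' H]; rewrite ?mem_head // inE H orbT.
- by move=> z; rewrite inE => /predU1P[->|/nB].
Qed.

(** * Ears and frames with three legs *)

Section Theta.
Variables (T : finType) (h : rel T) (zn : {set T}).
Hypotheses (hsym : symmetric h) (hirr : irreflexive h).
Hypotheses (hclaw : clawless h) (hdia : diamondless h) (hapex : apex_connected h zn).

(** If [Z] violates the cut condition, a set [Y] of at most one vertex separates it. By [apex_cut1]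
    nothing lies outside [Z :|: Y], so [B] would be contained in [Y]. *)
Lemma two_paths (B : {set T}) x y : 2 < #|B| -> x != y -> exists s t,
  [/\ path h x s && (last x s \in B), path h y t && (last y t \in B),
      uniq (x :: s), uniq (y :: t) & forall w, w \in x :: s -> w \notin y :: t].
Proof.
move=> cB xy; have [|P [P1 P2 P3]] := @menger T h [set x; y] B.
  move=> Z dZ; rewrite leqNgt; apply/negP => lt.
  pose A := [set x; y]; pose Y := outer h A Z :|: (A :\: Z).
  have cA : #|A| = 2 by rewrite cards2 xy.
  have cY : #|Y| <= 1.
    apply: leq_trans (leq_card_setU _ _) _; have := cardsID Z A; rewrite cA.
    move: lt; rewrite -/A; clear; lia.
  have Z0 : Z != set0.
    by apply: contraTneq lt => ->; rewrite setI0 cards0.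
  have cl a b : a \in Z -> h a b -> b \in Z :|: Y.
    move=> aZ ab; rewrite in_setU in_setU in_setD in_set; case: (boolP (b \in Z)) => //= bZ.
    case: (boolP (b \in A)) => bA; rewrite ?orbT //= orbF.
    by apply/existsP; exists a; rewrite aZ.
  have := apex_cut1 hapex Z0 cY cl => /setP E.
  have : B \subset Y.
    apply/subsetP => b bB; have := E b; rewrite in_setT in_setU => /orP[bZ|//].
    by move: dZ; rewrite disjoint_subset => /subsetP/(_ _ bZ); rewrite inE bB.
  by move/subset_leq_card; move: cB cY; clear; lia.
exists (P x), (P y); have [xA yA] : x \in [set x; y] /\ y \in [set x; y] by rewrite !inE !eqxx orbT.
split; [exact: P1|exact: P1|exact: P2|exact: P2|].
by move=> w wx; apply/negP => wy; have := P3 _ _ xA yA w wx wy; move/eqP; rewrite (negPf xy).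
Qed.

(** Disjoint paths to [B] from the two ends of an edge [x y], each stopped at its first vertex of
    [B], form the ear. *)
Lemma ear (B : {set T}) x : 2 < #|B| -> x \notin B -> exists q1 q2 I,
  [/\ q1 \in B, q2 \in B, q1 != q2 & [/\ x \in I, uniq I, {in I, forall w,
    w \notin B} & path h q1 (rcons I q2)]].
Proof.
move=> cB xB; have [y xy] : exists y, h x y.
  apply/existsP; apply: contraT; rewrite negb_exists => /forallP no.
  have X0 : [set x] != set0 by apply/set0Pn; exists x; rewrite inE.
  have := @apex_cut1 _ _ _ hapex [set x] set0 X0; rewrite cards0 => /(_ isT) H.
  have /H/setP E : forall a b, a \in [set x] -> h a b -> b \in [set x] :|: set0.
    by move=> a b; rewrite inE => /eqP-> ab; have := no b; rewrite ab.
  have /subset_leq_card : B \subset [set x].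
    by apply/subsetP => b _; have := E b; rewrite setU0 inE => ->.
  by rewrite cards1; move: cB; clear; lia.
have xny : x != y by apply: contraTneq xy => ->; rewrite hirr.
have [s0 [t0 [/andP[ps0 ls0] /andP[pt0 lt0] us0 ut0 dst0]]] := two_paths cB xny.
have [s [ps ls us ss bs]] := trim_path ps0 ls0 us0.
have [t [pt lt ut st bt]] := trim_path pt0 lt0 ut0.
have dst w : w \in x :: s -> w \notin y :: t.
  by move=> /ss /dst0; apply: contra => /st.
exists (last y t), (last x s), (rev (belast y t) ++ belast x s); split=> //.
  by apply/eqP => e; have := dst (last x s) (mem_last _ _); rewrite -e mem_last.
case: s ps ls us bs dst {ss} => [|x1 s] ps ls us bs dst; first by rewrite /= (negPf xB) in ls.
split.
- by rewrite mem_cat /= mem_head orbT.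
- have ubl (z : T) r : uniq (z :: r) -> uniq (belast z r).
    by rewrite lastI rcons_uniq => /andP[].
  rewrite cat_uniq rev_uniq (ubl _ _ ut) (ubl _ _ us) andbT andTb.
  apply/hasPn => w wb; rewrite /= mem_rev; apply/negP => wb'.
  by have := dst w (mem_belast wb); rewrite (mem_belast wb').
- by move=> w; rewrite mem_cat mem_rev => /orP[/bt|/bs].
rewrite rcons_cat -lastI cat_path; apply/andP; split.
  by rewrite rev_path (eq_path (e' := h)) // => u v; rewrite hsym.
have -> : last (last y t) (rev (belast y t)) = y.
  by case: (t) => //= y1 t'; rewrite rev_cons last_rcons.
by rewrite /= hsym xy.
Qed.

(* An ear of c through x gives a frame with three legs. *)
Lemma theta_covered (c : seq T) (U : {set T}) x : uniq c -> 2 < size c -> cycle h c -> x \notin c ->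
  {subset U <= c} -> 2 <= #|U| -> #|U| <= 4 -> covered h (x |: U).
Proof.
move=> uc sc cc xc Uc U2 U4; pose B := [set w in c].
have cB : 2 < #|B| by rewrite cardsE (card_uniqP uc).
have xB : x \notin B by rewrite inE.
have [q1 [q2 [I [q1B q2B q12 [xI uI dI pI]]]]] := ear cB xB.
move: q1B q2B; rewrite !inE => q1c q2c; have [i c' ec] := rot_to q1c.
have uc' : uniq (q1 :: c') by rewrite -ec rot_uniq.
have cc' : cycle h (q1 :: c') by rewrite -ec rot_cycle.
have q2c' : q2 \in c' by move: q2c; rewrite -(mem_rot i) ec inE eq_sym (negPf q12).
have cmem w : (w \in c) = (w \in q1 :: c') by rewrite -ec mem_rot.
have [k1 [k2 ek]] : exists k1 k2, c' = k1 ++ q2 :: k2 by case/splitPr: q2c' => k1 k2; exists k1, k2.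
have p1 : path h q1 (rcons k1 q2).
  by move: cc'; rewrite /= ek -cats1 -catA cat_path rcons_path /= cat_path /= =>
    /andP[-> /and3P[-> _ _]].
have p2 : path h q1 (rcons (rev k2) q2).
  have: path h q2 (rcons k2 q1).
    by move: cc'; rewrite /= ek rcons_cat cat_path /= => /and3P[].
  have := rev_path h q2 (rcons k2 q1); rewrite last_rcons belast_rcons rev_cons.
  by rewrite (eq_path (e' := h)) => [->|u v] //; rewrite hsym.
have uall : uniq ([:: q1; q2] ++ k1 ++ k2 ++ I).
  have : uniq ((q1 :: c') ++ I).
    rewrite cat_uniq uc' uI andbT /=; apply/hasPn => w /dI; by rewrite inE cmem.
  suff /perm_uniq -> : perm_eq ([:: q1; q2] ++ k1 ++ k2 ++ I) ((q1 :: c') ++ I) by [].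
  by apply/permP => a; rewrite ek /= !count_cat /=; clear; lia.
have split2 p : path h q1 (rcons p q2) ->
  exists D E, [/\ isnode h D, isnode h E, q1 \in D, q2 \in E & linked h D p E].
  by rewrite rcons_path => /andP[pp lp]; apply: arm_edge.
have [D1 [E1 [nD1 nE1 qD1 qE1 l1]]] := split2 _ p1.
have [D2 [E2 [nD2 nE2 qD2 qE2 l2]]] := split2 _ p2.
have [D3 [E3 [nD3 nE3 qD3 qE3 l3]]] := split2 _ pI.
have {}l1 := linked_rev hsym l1; have {}l2 := linked_rev hsym l2; have {}l3 := linked_rev hsym l3.
have u1 : uniq (q1 :: rev k1 ++ rev (rev k2) ++ rev I).
  have : perm_eq ((q1 :: rev k1 ++ rev (rev k2) ++ rev I) ++ [:: q2]) ([:: q1;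
    q2] ++ k1 ++ k2 ++ I).
    by apply/permP => a; rewrite /= !(count_cat, count_rev) /=; clear; lia.
  by move/perm_uniq; rewrite uall cat_uniq => /and3P[].
have [D [b1 [b2 [b3 [nD qD eb [s1 s2 s3]]]]]] := star hsym hirr hclaw hdia nD1 nD2 nD3 qD1 qD2
  qD3 l1 l2 l3 u1.
have {}s1 := linked_rev hsym s1; have {}s2 := linked_rev hsym s2; have {}s3 := linked_rev hsym s3.
set r1 := rev _ in s1; set r2 := rev _ in s2; set r3 := rev _ in s3.
have pr : perm_eq (q2 :: r1 ++ r2 ++ r3) ([:: q1; q2] ++ k1 ++ k2 ++ I).
  apply/permP => a; rewrite /r1 /r2 /r3 /= !(count_cat, count_rev, count_nseq) /=.
  have : a q1 * (b1 + b2 + b3) = a q1 by rewrite eb muln1.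
  by rewrite !mulnDr; clear; lia.
have u2 : uniq (q2 :: r1 ++ r2 ++ r3) by rewrite (perm_uniq pr).
have [D' [e1 [e2 [e3 [nD' qD' ee [t1 t2 t3]]]]]] := star hsym hirr hclaw hdia nE1 nE2 nE3 qE1 qE2
  qE3 s1 s2 s3 u2.
set f1 := r1 ++ _ in t1; set f2 := r2 ++ _ in t2; set f3 := r3 ++ _ in t3.
have pf : perm_eq (f1 ++ f2 ++ f3) ([:: q1; q2] ++ k1 ++ k2 ++ I).
  apply: perm_trans pr; apply/permP => a; rewrite /f1 /f2 /f3 /= !(count_cat, count_nseq) /=.
  have : a q2 * (e1 + e2 + e3) = a q2 by rewrite ee muln1.
  by rewrite !mulnDr; clear; lia.
have uf : uniq (f1 ++ f2 ++ f3) by rewrite (perm_uniq pf).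
pose V := x |: U.
have xU : x \notin U by apply: contra xc => /Uc.
have cV : #|V| = #|U|.+1 by rewrite cardsU1 xU.
have Vf : {subset V <= f1 ++ f2 ++ f3}.
  move=> w; rewrite (perm_mem pf) in_setU1 => /predU1P[->|/Uc]; first by rewrite !mem_cat xI !orbT.
  by rewrite cmem ek !(mem_cat, inE) => /or3P[->|->|/orP[]->]; rewrite ?orbT.
pose n f := count (mem V) f.
have nV : n f1 + n f2 + n f3 = #|V|.
  rewrite -addnA -!count_cat -size_filter -(card_uniqP (filter_uniq _ uf)).
  by apply: eq_card => w; rewrite mem_filter andb_idr //; apply: Vf.
pose st := theta (n f1, n f2, n f3).
have rst : real h V st.
  exists (fun w => if w == 0 then D else D'), [:: ((0, 1, n f1), f1); ((0, 1, n f2), f2);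
    ((0, 1, n f3), f3)], V.
  split=> //=.
  - by rewrite /leg_ok /= t1 t2 t3 !eqxx.
  - by move=> w _; case: (w == 0).
  - by rewrite /paths /= cats0.
  - split=> //; first by rewrite /paths /= cats0.
    by move=> w ->.
have stin : st \in map theta triples.
  apply: map_f; rewrite mem_filter; apply/andP; split; first by rewrite /= nV cV !ltnS U2 U4.
  have n5 f : f \in [:: n f1; n f2; n f3] -> f \in iota 0 6.
    rewrite mem_iota /= add0n => H; move: nV U4 H; rewrite cV !inE => e le H; move: H e le; clear.
    by move=> /or3P[] /eqP-> e le; lia.
  have [m1 m2 m3] : [/\ n f1 \in iota 0 6, n f2 \in iota 0 6 & n f3 \in iota 0 6].
    by split; apply: n5; rewrite !inE eqxx ?orbT.
  apply/allpairsPdep; exists (n f1, n f2), (n f3); split=> //.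
  by apply/allpairsPdep; exists (n f1), (n f2).
have V3 : 2 < #|V| by rewrite cV.
have [g|ng] := boolP (good st); first exact: (good_covered hsym hdia V3 rst g).
apply: (search_covered hsym hirr hclaw hdia hapex V3 search_roots _ rst).
by rewrite mem_filter ng.
Qed.
End Theta.

Lemma set_between (T : finType) (A B : {set T}) k : A \subset B -> #|A| <= k <= #|B| ->
  exists U : {set T}, [/\ A \subset U, U \subset B & #|U| = k].
Proof.
move=> sAB; have [m] := ubnP (k - #|A|); elim: m => // m IH in A sAB *.
rewrite ltnS => le /andP[Ak kB]; case: (eqVneq #|A| k) => [<-|ne]; first by exists A.
have /properP[_ [y yB yA]] : A \proper B.
  by rewrite properEcard sAB /=; move: Ak kB ne; clear; lia.
have [|||U [s1 s2 s3]] := IH (y |: A).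
- by rewrite subUset sub1set yB.
- by rewrite cardsU1 yA; move: le Ak ne; clear; lia.
- by rewrite cardsU1 yA kB andbT; move: Ak ne; clear; lia.
- by exists U; split=> //; apply: subset_trans s1; apply: subsetUr.
Qed.

Section Cover.
Variables (T : finType) (h : rel T) (zn : {set T}).
Hypotheses (hsym : symmetric h) (hirr : irreflexive h) (hapex : apex_connected h zn).
Hypothesis (cT : 2 < #|T|).

(** By [apex_cut1] a vertex [v] has two neighbours, and they are joined by a path avoiding [v]; [v]
    closes this path. *)
Lemma cycle_exists : exists c : seq T, [/\ uniq c, 2 < size c & cycle h c].
Proof.
have /card_gt0P[v _] : 0 < #|T| by apply: leq_ltn_trans cT.
pose N := [set y | h v y].
have [a [b [aN bN ab]]] : exists a b, [/\ a \in N, b \in N & a != b].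
  suff /card_gt1P[a [b [? ? ?]]] : 1 < #|N| by exists a, b.
  rewrite ltnNge; apply/negP => cN.
  have X0 : [set v] != set0 by apply/set0Pn; exists v; rewrite inE.
  have cl p q : p \in [set v] -> h p q -> q \in [set v] :|: N.
    by rewrite inE => /eqP-> vq; rewrite in_setU inE in_set vq orbT.
  have e := apex_cut1 hapex X0 cN cl; have := cardsU [set v] N.
  by rewrite e cardsT cards1; move: cT cN; clear; lia.
move: aN bN; rewrite !inE => va vb.
have ne w : h v w -> w != v by apply: contraTneq => ->; rewrite hirr.
pose r : rel T := [rel p q | h p q && (q != v)].
pose X := [set w | connect r a w].
have X0 : X != set0 by apply/set0Pn; exists a; rewrite inE.
have cl p q : p \in X -> h p q -> q \in X :|: [set v].
  rewrite !inE => ap pq; case: eqVneq => [_|qv]; first by rewrite orbT.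
  by rewrite orbF; apply: (connect_trans ap); apply: connect1; rewrite /r /= pq qv.
have := apex_cut1 hapex X0 _ cl; rewrite cards1 => /(_ isT)/setP/(_ b).
rewrite !inE (negPf (ne _ vb)) orbF => /connectP[p0 pp0 eb].
move: vb ab; rewrite eb; case/shortenP: pp0 => p pp up _ vb ab {b cl eb}.
have nv : v \notin a :: p.
  rewrite inE eq_sym (negPf (ne _ va)) /=; apply/negP => vp.
  elim: p (a) pp vp {up vb ab} => //= q p IH w /andP[/andP[_ qv] pp].
  by rewrite inE eq_sym (negPf qv) /=; apply: IH pp.
exists (v :: a :: p); split.
- by rewrite cons_uniq nv.
- by case: (p) ab => //=; rewrite eqxx.
rewrite /= va rcons_path hsym vb andbT /=.
by apply: sub_path pp => q w /andP[].
Qed.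

Hypotheses (hclaw : clawless h) (hdia : diamondless h).

(** Each round keeps the specials already on the cycle and gains a missing one, [x]; as one is
    missing, at most four have to be kept. *)
Lemma diamondless_covered (S : {set T}) : 2 < #|S| -> #|S| <= 5 -> covered h S.
Proof.
move=> S3 S5; have [c0 [u0 s0 y0]] := cycle_exists.
suff: forall n c, #|S :\: [set w in c]| <= n -> uniq c -> 2 < size c -> cycle h c -> covered h S.
  by move/(_ _ c0 (leqnn _) u0 s0 y0).
move=> n; elim: n => [|n IH] c le uc sc cc.
  move: le; rewrite leqn0 cards_eq0 setD_eq0 => /subsetP sS; exists c; split=> // w /sS.
  by rewrite inE.
pose B := [set w in c]; have cB : 2 < #|B| by rewrite cardsE (card_uniqP uc).
have [e|] := eqVneq (S :\: B) set0; first by apply: IH uc sc cc; rewrite e cards0.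
case/set0Pn=> x; rewrite !inE => /andP[xc xS].
have cSB : #|S :&: B| <= 4.
  have := cardsID B S; have : 0 < #|S :\: B| by apply/card_gt0P; exists x; rewrite !inE xc.
  by move: S5; clear; lia.
(* If necessary [U] is padded with vertices of the cycle, since the search starts from frames with
   at least three specials. *)
have [U [sU UB [U2 U4]]] : exists U : {set T}, [/\ S :&: B \subset U,
  U \subset B & 2 <= #|U| /\ #|U| <= 4].
  case: (leqP 2 #|S :&: B|) => c2; first by exists (S :&: B); rewrite subsetIr.
  have [|U [s1 s2 s3]] := @set_between _ (S :&: B) B 2 (subsetIr _ _).
    by rewrite ltnW //= ltnW.
  by exists U; rewrite s3.
have Uc : {subset U <= c} by move=> w /(subsetP UB); rewrite inE.
have [c' [uc' sc' cc' sub]] := theta_covered hsym hirr hclaw hdia hapex uc sc cc xc Uc U2 U4.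
apply: IH uc' sc' cc'; rewrite -ltnS; apply: leq_trans le; apply: proper_card; apply/properP; split.
  apply/subsetP => w; rewrite !inE => /andP[wc' wS]; rewrite wS andbT; apply: contra wc' => wc.
  by apply: sub; rewrite in_setU1 (subsetP sU) ?orbT // !inE wS.
by exists x; rewrite !inE ?xc // negb_and negbK sub // in_setU1 eqxx.
Qed.
End Cover.

Lemma apex_covered (T : finType) (h : rel T) (zn S : {set T}) :
  symmetric h -> irreflexive h -> clawless h -> apex_connected h zn -> 2 < #|T| ->
  2 < #|S| -> #|S| <= 5 -> covered h S.
Proof.
move=> hsym hirr hclaw hapex cT S3 S5.
have [h' [s1 s2 s3 s4 [s5 s6]]] := diamondless_closure hsym hirr hclaw.
have [c [uc sc cc Sc]] := diamondless_covered s1 s2 (apex_mono s5 hapex) cT s3 s4 S3 S5.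
have [c' [? ? ? sub]] := s6 c uc sc cc.
by exists c'; split=> // w /Sc/sub.
Qed.
Require Import Defs.

(** * Deleting a vertex *)

Lemma claw_free_clawless (V : finType) (e : rel V) :
  simple_graph e -> claw_free e -> clawless e.
Proof.
move=> [esym eirr] hc y a b c ya yb yc; rewrite /= !inE negb_or => /andP[/andP[ab ac] /andP[bc _]].
apply: contraT; rewrite !negb_or => /and3P[nab nac nbc]; exfalso; apply: hc.
have ne w : e y w -> y != w by apply: contraTneq => ->; rewrite eirr.
pose g (i : 'I_3) := nth y [:: a; b; c] i.
exists (fun u => match u with inl _ => y | inr i => g i end); split.
  move=> [i|[[|[|[|i]]] ip]] [j|[[|[|[|j]]] jp]] //= ex; do ?[by congr inl;
    rewrite (ord1 i) (ord1 j)];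
    try (by congr inr; apply: val_inj);
    by [move: (ne _ ya) (ne _ yb) (ne _ yc) ab ac bc; rewrite /g /= in ex *; rewrite ex eqxx
       |move: (ne _ ya) (ne _ yb) (ne _ yc) ab ac bc; rewrite /g /= in ex *; rewrite -ex eqxx].
move=> [i|[[|[|[|i]]] ip]] [j|[[|[|[|j]]] jp]] //=;
  rewrite /g /= ?eirr ?ya ?yb ?yc // ?[e _ y]esym ?ya ?yb ?yc //.
all: by rewrite ?(negPf nab) ?(negPf nac) ?(negPf nbc) // esym ?(negPf nab) ?(negPf nac) ?(negPf
  nbc).
Qed.

Section Delete.
Variables (V : finType) (e : rel V) (z : V).
Hypotheses (hG : simple_graph e) (hconn : k_connected 3 e) (hclaw : claw_free e).

Let T := {y : V | y != z}.
Definition deleted : rel T := fun u v => e (val u) (val v).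
Definition deleted_nbrs : {set T} := [set u | e z (val u)].

Lemma deleted_sym : symmetric deleted.
Proof. by move=> u v; rewrite /deleted hG.1. Qed.

Lemma deleted_irr : irreflexive deleted.
Proof. by move=> u; rewrite /deleted hG.2. Qed.

Lemma deleted_clawless : clawless deleted.
Proof.
move=> y a b c ya yb yc u; apply: (claw_free_clawless hG hclaw ya yb yc).
by rewrite -[[:: _; _; _]]/(map val [:: a; b; c]) map_inj_uniq //; apply: val_inj.
Qed.

(** If [z] is in [W] or has no neighbour in [X], then [W] separates [X] from a vertex outside
    [X :|: Y], although it has fewer than three vertices. *)
Lemma deleted_cut (X Y : {set T}) (W : {set V}) : X != set0 -> X :|: Y != setT ->
  (forall a b, a \in X -> deleted a b -> b \in X :|: Y) ->
  #|W| < 3 -> (forall y, (val y \in W) = (y \in Y :\: X)) ->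
  z \notin W /\ exists2 a, a \in X & a \in deleted_nbrs.
Proof.
move=> /set0Pn[a aX] XY cl cW WY.
have [b bXY] : exists b, b \notin X :|: Y.
  by apply/existsP; rewrite -negb_forall; apply: contra XY => /forallP H; apply/eqP/setP => w;
    rewrite H inE.
move: bXY; rewrite inE negb_or => /andP[bX bY].
have aW : val a \in ~: W by rewrite inE WY inE aX.
have bW : val b \in ~: W by rewrite inE WY inE (negPf bY) andbF.
have := hconn.2 W cW (val a) (val b) aW bW => con.
suff [zW [c cX cz]] : z \notin W /\ exists2 a, a \in X & e z (val a) by split=> //; exists c;
  rewrite ?inE.
have [//|no] := boolP ((z \notin W) && [exists c in X, e z (val c)]).
  by case/andP=> zW /existsP[c /andP[cX cz]]; split=> //; exists c.
exfalso; pose A := val @: X.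
have step p q : induced_rel e (~: W) p q -> p \in A -> q \in A.
  case/and3P=> _ qW pq /imsetP[c cX ep]; subst p.
  have [eq|qz] := eqVneq q z.
    subst q; case/negP: no; rewrite inE in qW; rewrite qW /=; apply/existsP; exists c.
    by rewrite cX hG.1.
  pose q' : T := Sub q qz; have := cl c q' cX pq; rewrite inE => /orP[qX|qY].
    by apply/imsetP; exists q'.
  have [qX|qX] := boolP (q' \in X); first by apply/imsetP; exists q'.
  by move: qW; rewrite inE -[q]/(val q') WY inE qX qY.
have cA : closed (induced_rel e (~: W)) (mem A).
  move=> p q pq; apply/idP/idP; first exact: step pq.
  by apply: step; case/and3P: pq => pW qW pq; rewrite /induced_rel /= pW qW hG.1.
have := closed_connect cA con; rewrite imset_f // => /esym/imsetP[c cX /val_inj ec].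
by rewrite ec cX in bX.
Qed.

Lemma deleted_apex : apex_connected deleted deleted_nbrs.
Proof.
have sub_val (Y X : {set T}) y : (val y \in [set val y | y in Y :\: X]) = (y \in Y :\: X).
  by rewrite mem_imset //; apply: val_inj.
have card_val (Y X : {set T}) : #|[set val y | y in Y :\: X]| <= #|Y|.
  by rewrite card_imset; [apply/subset_leq_card/subsetDl|apply: val_inj].
split.
- move=> X Y X0 Y1 cl; apply/eqP; apply: contraT => XY; exfalso.
  (* Here [z] itself belongs to the cut, which leaves room for one further vertex. *)
  have [||//] := @deleted_cut X Y (z |: [set val y | y in Y :\: X]) X0 XY cl.
  + by rewrite (leq_ltn_trans (leq_card_setU _ _)) // cards1 ltnS (leq_ltn_trans (card_val _ _)).
  + by move=> y; rewrite in_setU1 (negPf (valP y)) sub_val.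
  by rewrite in_setU1 eqxx.
- move=> X Y X0 Y2 cl XY.
  have [||//] := @deleted_cut X Y [set val y | y in Y :\: X] X0 XY cl.
  + by rewrite ltnS (leq_trans (card_val _ _)).
  + by move=> y; rewrite sub_val.
- move=> a b c; rewrite !inE => az bz cz u; apply: (claw_free_clawless hG hclaw az bz cz).
  by rewrite -[[:: _; _; _]]/(map val [:: a; b; c]) map_inj_uniq //; apply: val_inj.
Qed.
End Delete.

Theorem theorem1p3 (V : finType) (e : rel V) (S : {set V}) (z : V)
    (hG : simple_graph e)
    (hconn : k_connected 3 e)
    (hclaw : claw_free e)
    (hS : #|S| <= 6)
    (hz : z \in S) :
  exists c : seq V,
    [/\ graph_cycle e c, z \notin c & {subset S :\ z <= c}].
Proof.
pose T : finType := {y : V | y != z}.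
have cT : #|T| = #|V|.-1 by rewrite card_sig (cardC1 z).
pose S0 : {set T} := [set y : T | val y \in S].
have cS0 : #|S0| <= 5.
  rewrite -(card_imset _ val_inj) -ltnS (leq_trans _ hS) //.
  apply: proper_card; apply/properP; split.
    by apply/subsetP => _ /imsetP[y + ->]; rewrite inE.
  by exists z => //; apply/imsetP => -[y _ ez]; have := valP y; rewrite -ez eqxx.
have cV := hconn.1.
(* A small [S0] is enlarged to three vertices; there are enough of them because [V] has more than
   three. *)
have [S1 [sS S3 S5]] : exists S1 : {set T}, [/\ S0 \subset S1, 2 < #|S1| & #|S1| <= 5].
  case: (leqP 3 #|S0|) => c3; first by exists S0.
  have [|S1 [s1 _ s3]] := @set_between _ S0 setT 3 (subsetT _); last by exists S1; rewrite s3.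
  by rewrite ltnW // cardsT cT; move: cV; clear; lia.
have T3 : 2 < #|T| by rewrite cT; move: cV; clear; lia.
have [c [uc sc cc Sc]] := apex_covered (@deleted_sym V e z hG) (@deleted_irr V e z hG)
  (@deleted_clawless V e z hG hclaw) (@deleted_apex V e z hG hconn hclaw) T3 S3 S5.
exists (map val c); split.
- split; first by rewrite size_map.
  apply/andP; split; last by rewrite map_inj_uniq //; apply: val_inj.
  by case: (c) cc => //= y s; rewrite -map_rcons path_map.
- by apply/mapP => -[y _ ez]; have := valP y; rewrite -ez eqxx.
move=> y; rewrite !inE => /andP[yz yS]; apply/mapP; exists (Sub y yz : T) => //.
by apply: Sc; apply: (subsetP sS); rewrite inE.
Qed.
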